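(* Let $a>0$ and $b>0$, and let $f_h,f_h',f_h'',f_h'''$ be the solution of the Gamma--Stein equation for $\mathcal G_{a,b}$ and the pointwise representatives of its derivatives defined in the context. If $h\in\mathcal Z_1$, then $$\|f_h\|_\infty\le1,\qquad \|f_h'\|_\infty\le\frac{c_a}{b},\qquad \|xf_h'\|_\infty\le d_a,\qquad \|xf_h''\|_\infty\le\frac2b.$$ If $h\in\mathcal Z_2$, then $$\|f_h''\|_\infty\le\frac{e_a}{b},\qquad \|xf_h'''\|_\infty\le\frac2b.$$
   Context: $\mathcal G_{a,b}$ denotes the Gamma distribution with shape $a>0$ and scale $b>0$, with density $p_{a,b}(x)=\frac{1}{\Gamma(a)b^a}x^{a-1}e^{-x/b}\mathbf 1_{\{x>0\}}$. $\mathcal Z_1$ is the class of continuously differentiable $h:(0,\infty)\to\mathbb R$ with $\|h'\|_\infty\le1$; $\mathcal Z_2$ is the class of twice continuously differentiable $h:(0,\infty)\to\mathbb R$ with $\|h''\|_\infty\le1$. All norms $\|\cdot\|_\infty$ are suprema over $(0,\infty)$; $\|xf_h'\|_\infty$ means $\sup_{x>0}|xf_h'(x)|$, etc. For $x,y>0$ put $P_{a,b}(x)=\int_0^xp_{a,b}(u)\,du$, $\overline P_{a,b}(x)=\int_x^\infty p_{a,b}(u)\,du$, $\underline{\mathrm P}^1_{a,b}(x)=\int_0^xP_{a,b}(u)\,du$, $\overline{\mathrm P}^1_{a,b}(x)=\int_x^\infty\overline P_{a,b}(u)\,du$, $\underline M_{a,b}(y)=\frac{P_{a,b}(y)}{by\,p_{a,b}(y)}$,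 $\overline M_{a,b}(y)=\frac{\overline P_{a,b}(y)}{by\,p_{a,b}(y)}$ (smooth on $(0,\infty)$). Set $$C_{a,b}^1(y)=-\overline M_{a,b}'(y)\underline{\mathrm P}^1_{a,b}(y)+\underline M_{a,b}'(y)\overline{\mathrm P}^1_{a,b}(y),$$ $$C_{a,b}^2(y)=\overline M_{a,b}''(y)\int_0^y\underline{\mathrm P}^1_{a,b}(x)\,dx+\underline M_{a,b}''(y)\int_y^\infty\overline{\mathrm P}^1_{a,b}(x)\,dx,$$ and $c_a:=\sup_{z>0}C_{a,1}^1(z)$, $d_a:=\sup_{z>0}zC_{a,1}^1(z)$, $e_a:=\sup_{z>0}C_{a,1}^2(z)$, which are finite. Kernels: for $k\in\{0,1,2\}$, with $M^{(k)}$ the $k$-th derivative, $$K_{a,b}^{k,1}(x,y)=-\overline M_{a,b}^{(k)}(y)\frac{P_{a,b}(x)}{p_{a,b}(x)}\mathbf 1_{\{x\le y\}}-\underline M_{a,b}^{(k)}(y)\frac{\overline P_{a,b}(x)}{p_{a,b}(x)}\mathbf 1_{\{x>y\}},$$ and $$K_{a,b}^{3,2}(x,y)=\overline M_{a,b}'''(y)\frac{\underline{\mathrm P}^1_{a,b}(x)}{p_{a,b}(x)}\mathbf 1_{\{x\le y\}}-\underline M_{a,b}'''(y)\frac{\overline{\mathrm P}^1_{a,b}(x)}{p_{a,b}(x)}\mathbf 1_{\{x>y\}}.$$ With $X\sim\mathcal G_{a,b}$ and $x>0$ define $f_h(x)=\mathbb E[h'(X)K_{a,b}^{0,1}(X,x)]$,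 $f_h'(x)=\mathbb E[h'(X)K_{a,b}^{1,1}(X,x)]$, $f_h''(x)=\mathbb E[h'(X)K_{a,b}^{2,1}(X,x)]+\frac{h'(x)}{bx}$, $f_h'''(x)=\mathbb E[h''(X)K_{a,b}^{3,2}(X,x)]+\frac{h''(x)}{bx}$ (the last for $h\in\mathcal Z_2$). These are the solution $f_h$ of $bxf'(x)-(x-ab)f(x)=h(x)-\int_0^\infty h(u)p_{a,b}(u)\,du$, $x>0$, and its successive derivatives on $(0,\infty)$. *)

(* Defs.v *)
From HB Require Import structures.
From mathcomp Require Import all_boot all_order all_algebra.
From mathcomp Require Import all_classical all_reals all_analysis.
From mathcomp Require Import measurable_realfun.
Set Implicit Arguments.
Unset Strict Implicit.
Unset Printing Implicit Defensive.
Import Order.TTheory GRing.Theory Num.Theory.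
Import numFieldNormedType.Exports.
Local Open Scope ring_scope.
Local Open Scope classical_set_scope.

Section gamma_distribution.
Context {R : realType}.
Notation mu := (@lebesgue_measure R).
Variables a b : R.

Definition Gamma (s : R) : R :=
  \int[mu]_(t in `]0, +oo[) (t `^ (s - 1) * expR (- t)).

Definition gamma_pdf (x : R) : R :=
  if 0 < x then (Gamma a * b `^ a)^-1 * x `^ (a - 1) * expR (- (x / b)) else 0.

Definition gamma_dist (V : set R) : \bar R :=
  (\int[mu]_(x in V) (gamma_pdf x)%:E)%E.

Lemma Gamma_ge0 (s : R) : 0 <= Gamma s.
Proof.
by apply: Rintegral_ge0 => t _; rewrite mulr_ge0 ?powR_ge0 ?expR_ge0.
Qed.

Lemma gamma_pdf_ge0 (x : R) : 0 <= gamma_pdf x.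
Proof.
rewrite /gamma_pdf; case: ifP => // _.
by rewrite !mulr_ge0 ?invr_ge0 ?mulr_ge0 ?Gamma_ge0 ?powR_ge0 ?expR_ge0.
Qed.

Lemma measurable_gamma_pdf : measurable_fun [set: R] gamma_pdf.
Proof.
apply: measurable_fun_ifT => //.
  exact: measurable_fun_ltr.
apply: measurable_funM; last first.
  by do 2 apply: measurableT_comp => //; exact: measurable_funM.
by apply: measurable_funM => //; exact: measurable_powR.
Qed.

Let gamma_dist0 : gamma_dist set0 = 0%E.
Proof. by rewrite /gamma_dist integral_set0. Qed.

Let gamma_dist_ge0 A : (0 <= gamma_dist A)%E.
Proof. by apply: integral_ge0 => x _; rewrite lee_fin gamma_pdf_ge0. Qed.

Let gamma_dist_sigma_additive : semi_sigma_additive gamma_dist.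
Proof.
move=> /= F mF tF mUF; rewrite /gamma_dist; apply: cvg_toP.
  apply: ereal_nondecreasing_is_cvgn => m n mn.
  apply: lee_sum_nneg_natr => // k _ _; apply: integral_ge0 => /= x Fkx.
  by rewrite lee_fin gamma_pdf_ge0.
rewrite ge0_integral_bigcup//=.
- by apply/measurable_funTS/measurableT_comp => //; exact: measurable_gamma_pdf.
- by move=> x _; rewrite lee_fin gamma_pdf_ge0.
Qed.

HB.instance Definition _ := isMeasure.Build _ _ _
  gamma_dist gamma_dist0 gamma_dist_ge0 gamma_dist_sigma_additive.

End gamma_distribution.

Section sup_norm.
Context {R : realType}.

(* The pointwise (not essential) supremum over (0, oo), possibly +oo. *)
Definition supnorm (f : R -> R) : \bar R :=
  ereal_sup [set `|f x|%:E | x in `]0, +oo[].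

(* Only the values of h on (0, oo) matter in the two classes below. *)
Definition Z1 (h : R -> R) : Prop :=
  [/\ forall x : R, 0 < x -> derivable h x 1,
      forall x : R, 0 < x -> {for x, continuous (derive1n 1 h)} &
      (supnorm (derive1n 1 h) <= 1)%E].

Definition Z2 (h : R -> R) : Prop :=
  [/\ forall x : R, 0 < x -> derivable h x 1,
      forall x : R, 0 < x -> derivable (derive1n 1 h) x 1,
      forall x : R, 0 < x -> {for x, continuous (derive1n 2 h)} &
      (supnorm (derive1n 2 h) <= 1)%E].

End sup_norm.

Section kernels.
Context {R : realType}.
Notation mu := (@lebesgue_measure R).
Variables a b : R.
Local Notation p := (gamma_pdf a b).

Definition P_lower (x : R) : R := \int[mu]_(u in `[0, x]) p u.

Definition P_upper (x : R) : R := \int[mu]_(u in `[x, +oo[) p u.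

Definition P1_lower (x : R) : R := \int[mu]_(u in `[0, x]) P_lower u.

Definition P1_upper (x : R) : R := \int[mu]_(u in `[x, +oo[) P_upper u.

Definition M_lower (y : R) : R := P_lower y / (b * y * p y).

Definition M_upper (y : R) : R := P_upper y / (b * y * p y).

Definition C1 (y : R) : R :=
  - derive1n 1 M_upper y * P1_lower y + derive1n 1 M_lower y * P1_upper y.

Definition C2 (y : R) : R :=
  derive1n 2 M_upper y * \int[mu]_(x in `[0, y]) P1_lower x
  + derive1n 2 M_lower y * \int[mu]_(x in `[y, +oo[) P1_upper x.

Definition K1 (k : nat) (x y : R) : R :=
  - derive1n k M_upper y * (P_lower x / p x) * (x <= y)%R%:R
  - derive1n k M_lower y * (P_upper x / p x) * (x > y)%R%:R.

Definition K32 (x y : R) : R :=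
  derive1n 3 M_upper y * (P1_lower x / p x) * (x <= y)%R%:R
  - derive1n 3 M_lower y * (P1_upper x / p x) * (x > y)%R%:R.

(* Expectation of g X for X with the Gamma law. In the uses below g vanishes
   on the nonpositive reals (there p is 0 and division by 0 yields 0), so the
   values of h outside (0, oo) play no role. *)
Definition gamma_expectation (g : R -> R) : R :=
  \int[gamma_dist a b]_u g u.

Variable h : R -> R.

Definition stein_sol (x : R) : R :=
  gamma_expectation (fun u => derive1n 1 h u * K1 0 u x).

Definition stein_sol' (x : R) : R :=
  gamma_expectation (fun u => derive1n 1 h u * K1 1 u x).

Definition stein_sol'' (x : R) : R :=
  gamma_expectation (fun u => derive1n 1 h u * K1 2 u x)
  + derive1n 1 h x / (b * x).

Definition stein_sol''' (x : R) : R :=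
  gamma_expectation (fun u => derive1n 2 h u * K32 u x)
  + derive1n 2 h x / (b * x).

End kernels.

(* Real suprema: [sup] is 0 on a set without an upper bound, so an upper bound
   by one of these constants also carries its finiteness. *)
Definition c_const {R : realType} (a : R) : R :=
  sup [set C1 a 1 z | z in `]0, +oo[].

Definition d_const {R : realType} (a : R) : R :=
  sup [set z * C1 a 1 z | z in `]0, +oo[].

Definition e_const {R : realType} (a : R) : R :=
  sup [set C2 a 1 z | z in `]0, +oo[].

(* Main.v *)
Require Import Defs.
From mathcomp Require Import all_boot all_order all_algebra.
From mathcomp Require Import all_classical all_reals all_analysis.
From mathcomp Require Import measurable_realfun ring lra.
Import Order.TTheory GRing.Theory Num.Theory.
Import numFieldNormedType.Exports.
Set Implicit Arguments.
Unset Strict Implicit.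
Unset Printing Implicit Defensive.
Local Open Scope ring_scope.
Local Open Scope classical_set_scope.

(* Write s(y) = b y p(y), A_0 = P, B_0 = 1 - P, and let A_k, B_k be the k-fold
   iterated integrals of A_0 from 0 and of B_0 from +oo. Integrating
   s' = (a b - y) p repeatedly gives, with A_(-1) = B_(-1) = p,
     (k + 1) A_(k+1) = b y A_(k-1) + (y - a b - k b) A_k,
     (k + 1) B_(k+1) = b y B_(k-1) - (y - a b - k b) B_k,
   hence, by induction on k,
     (P / s)^(k) = k! A_k / (s (b y)^k),
     ((1 - P) / s)^(k) = (-1)^k k! B_k / (s (b y)^k).
   So every derivative occurring in a kernel has a constant sign, and integrating
   the absolute value of a kernel produces (B_k A_j + A_k B_j) / (s (b y)^k) up to
   a factor k!. For k = j + 1 the recurrences collapse this to an exact value,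
   (j + 1)! (B_(j+1) A_j + A_(j+1) B_j) = s (b y)^j, which gives the bounds 1 and
   2 / b; the other bounds are C^1 and C^2, rescaled to b = 1. For h in Z_2 the
   bound on f_h'' follows by integrating h' against its kernel by parts: the
   boundary terms cancel h'(x) / (b x). Finally C^1, y C^1 and C^2 are bounded
   (so that their suprema are not junk) because A_(k+1) <= y A_k and B_2 >= 0. *)

Lemma is_derive_continuous {R : realType} (f : R -> R) (x df : R) :
  is_derive x 1 f df -> {for x, continuous f}.
Proof.
by move=> [df1 _]; apply: differentiable_continuous; exact/derivable1_diffP.
Qed.

(** * Exponential decay against powers *)

Section growth.
Context {R : realType}.
Notation mu := (@lebesgue_measure R).
Implicit Types (r c t x : R).

(** A single term [(c t)^(n+1) / (n+1)!] of the exponential series suffices once [n + 1] exceeds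
    [|r|]; for [t >= 1] raising the exponent from [r] to [n + 1] only increases the power. *)
Lemma powR_le_expR r c : 0 < c ->
  exists2 C, 0 < C & forall t, 1 <= t -> t `^ r <= C * expR (c * t).
Proof.
move=> c0; set n := Num.truncn `|r|.
exists (n.+1`!%:R / c ^+ n.+1).
  by rewrite divr_gt0 ?exprn_gt0// ltr0n fact_gt0.
move=> t t1; have t0 : 0 < t by exact: lt_le_trans t1.
apply: (@le_trans _ _ (t ^+ n.+1)).
  rewrite -powR_mulrn; last exact: ltW.
  apply: ler_powR => //; apply: (le_trans (ler_norm _)).
  by rewrite ltW// truncnS_gt.
have := @expR_ge1Dxn R (c * t) n (mulr_ge0 (ltW c0) (ltW t0)).
rewrite exprMn => H.
rewrite mulrAC ler_pdivlMr ?exprn_gt0// [leLHS]mulrC -ler_pdivrMl ?ltr0n ?fact_gt0//.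
by apply: le_trans H; rewrite [leLHS]mulrC lerDr.
Qed.

Lemma cvg_expRNM_pinfty c : 0 < c -> expR (- (c * t)) @[t --> +oo%R] --> (0 : R).
Proof.
move=> c0; have := @cvgr_expR R.
apply: (@cvg_comp _ _ _ (fun t => c * t) (fun t => expR (- t))).
by apply: gt0_cvgMry => //; exact: cvg_id.
Qed.

Lemma cvg_powR_expRN_pinfty r c : 0 < c ->
  t `^ r * expR (- (c * t)) @[t --> +oo%R] --> (0 : R).
Proof.
move=> c0; have c20 : 0 < c / 2 by rewrite divr_gt0.
have [C C0 HC] := powR_le_expR r c20.
apply: (@squeeze_cvgr _ _ _ _ (fun=> 0) (fun t => C * expR (- (c / 2 * t)))).
- near=> t.
  have t1 : 1 <= t by near: t; apply: nbhs_pinfty_ge; exact: num_real.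
  rewrite mulr_ge0 ?powR_ge0 ?expR_ge0//=.
  (* Half of the rate absorbs the power, the other half still tends to 0. *)
  have -> : expR (- (c / 2 * t)) = expR (c / 2 * t) * expR (- (c * t)).
    by rewrite -expRD; congr expR; field.
  by rewrite mulrA ler_pM2r ?expR_gt0// HC.
- exact: cvg_cst.
- rewrite -[X in _ --> X](mulr0 C).
  by apply: cvgM; [exact: cvg_cst|exact: cvg_expRNM_pinfty].
Unshelve. all: by end_near. Qed.

Lemma integral_expRN_itvcy c x : 0 < c ->
  (\int[mu]_(t in `[x, +oo[) (expR (- (c * t)))%:E = (c^-1 * expR (- (c * x)))%:E)%E.
Proof.
move=> c0.
have dF t : is_derive t 1 (fun t => - (c^-1 * expR (- (c * t)))) (expR (- (c * t))).
  apply: is_derive_eq.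
  by rewrite /GRing.scale/= mulr1; field; rewrite gt_eqF.
have ct t : {for t, continuous (fun t => expR (- (c * t)))}.
  apply: (@continuous_comp _ _ _ (fun t => - (c * t)) expR); last exact: continuous_expR.
  by apply: cvgN; apply: cvgM; [exact: cvg_cst|exact: cvg_id].
have cF t : {for t, continuous (fun t => - (c^-1 * expR (- (c * t))))}.
  exact: is_derive_continuous (dF t).
rewrite (@ge0_continuous_FTC2y _ _ (fun t => - (c^-1 * expR (- (c * t)))) _ 0).
- by rewrite -EFinB sub0r opprK.
- by move=> t _; exact: expR_ge0.
- by apply: continuous_subspaceT => t; exact: ct.
- rewrite -oppr0 -(mulr0 c^-1); apply: cvgN; apply: cvgM; first exact: cvg_cst.
  exact: cvg_expRNM_pinfty.
- by move=> t _; have [] := dF t.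
- by apply: cvg_at_right_filter; exact: cF.
- by move=> t _; rewrite derive1E; have [_ ->] := dF t.
Qed.

End growth.

(** * The Gamma density and its distribution function *)

Section weight.
Context {R : realType}.
Notation mu := (@lebesgue_measure R).
Variable (a : R).
Hypothesis a_gt0 : 0 < a.
Implicit Types (b t x : R).

Lemma is_derive_powR (r x : R) : 0 < x ->
  is_derive x 1 (fun t => t `^ r) (r * x `^ (r - 1)).
Proof.
move=> x0; have xi : x \in `]0, +oo[%R by rewrite in_itv/= x0.
apply: DeriveDef; first exact: derivable_powR.
by have := powR_derive1 r xi; rewrite derive1E.
Qed.

Lemma continuous_powR (r x : R) : 0 < x -> {for x, continuous (fun t => t `^ r)}.
Proof. by move=> x0; exact: is_derive_continuous (is_derive_powR r x0).
Qed.

(** The power may be singular at 0, so []0, 1]] is exhausted by the intervals [[1/(n+1), 1]]. On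
    each of them the primitive [t^a / a] bounds the integral by [1 / a], and monotone convergence
    passes this bound to the limit. *)
Lemma integrable_powR01 : mu.-integrable `]0, 1] (fun t => (t `^ (a - 1))%:E).
Proof.
have mf : measurable_fun setT (fun t : R => t `^ (a - 1)) by exact: measurable_powR.
apply/integrableP; split.
  by apply/measurable_EFinP; exact: measurable_funTS.
under eq_integral do rewrite /= ger0_norm ?powR_ge0//.
pose F (n : nat) : set R := `[n.+1%:R^-1, 1]%classic.
have F01 : \bigcup_i F i = `]0, 1]%classic.
  apply/seteqP; split => [x [n _]|x] /=.
    rewrite /F/= !in_itv/= => /andP[nx ->]; rewrite andbT.
    by rewrite (lt_le_trans _ nx)// invr_gt0.
  rewrite in_itv/= => /andP[x0 x1].
  exists (Num.truncn x^-1) => //; rewrite /F/= in_itv/= x1 andbT.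
  by rewrite -[leRHS]invrK lef_pV2 ?posrE ?invr_gt0// ltW// truncnS_gt.
have : (\int[mu]_(x in F i) (x `^ (a - 1))%:E)%E @[i --> \oo] -->
       (\int[mu]_(x in \bigcup_i F i) (x `^ (a - 1))%:E)%E.
  apply: ge0_nondecreasing_set_cvg_integral.
  - move=> n m nm; apply/subsetPset; apply: subset_itvr.
    by rewrite bnd_simp lef_pV2 ?posrE// ler_nat.
  - by move=> i; exact: measurable_itv.
  - by move=> i; apply/measurable_EFinP; exact: measurable_funTS.
  - by move=> i x _; rewrite lee_fin powR_ge0.
rewrite F01 => Fcvg.
rewrite (@le_lt_trans _ _ (a^-1)%:E) ?ltry//.
rewrite -(cvg_lim _ Fcvg)//; apply: lime_le; first by apply/cvg_ex; eexists; exact: Fcvg.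
apply: nearW => n; rewrite /F.
(* The fundamental theorem is applied to a nondegenerate interval; a single point or an empty
   interval has integral 0. *)
have [|n1] := leP 1 (n.+1%:R^-1 : R).
  rewrite le_eqVlt => /predU1P[<-|n1]; first by rewrite set_itv1 integral_set1 lee_fin invr_ge0 ltW.
  by rewrite set_itv_ge ?integral_set0 ?lee_fin ?invr_ge0 ?ltW// bnd_simp -ltNge.
have n0 : 0 < (n.+1%:R^-1 : R) by rewrite invr_gt0.
have dF x : 0 < x -> is_derive x 1 (fun t => a^-1 * t `^ a) (x `^ (a - 1)).
  move=> x0; apply: is_derive_eq; first by apply: is_deriveM; exact: is_derive_powR.
  by rewrite scaler0 addr0 /GRing.scale/= mulrA mulVf ?gt_eqF// mul1r.
rewrite (@continuous_FTC2 _ _ (fun t => a^-1 * t `^ a))//.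
- by rewrite powR1 mulr1 -EFinB lee_fin gerBl mulr_ge0 ?powR_ge0 ?invr_ge0 ?ltW.
- apply: continuous_in_subspaceT => x; rewrite inE/= in_itv/= => /andP[nx _].
  by apply: continuous_powR; exact: lt_le_trans nx.
- split.
  + by move=> x; rewrite in_itv/= => /andP[nx _]; have [] := dF _ (lt_trans n0 nx).
  + apply: cvg_at_right_filter; exact: is_derive_continuous (dF _ n0).
  + apply: cvg_at_left_filter; exact: is_derive_continuous (dF _ (@ltr01 R)).
- move=> x; rewrite in_itv/= => /andP[nx _]; rewrite derive1E.
  by have [_ ->] := dF _ (lt_trans n0 nx).
Qed.

End weight.

Section gamma_law.
Context {R : realType}.
Notation mu := (@lebesgue_measure R).
Variables (a b : R).
Hypothesis a_gt0 : 0 < a.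
Hypothesis b_gt0 : 0 < b.
Local Notation p := (gamma_pdf a b).

Lemma gamma_pdfE x : 0 < x ->
  p x = (Gamma a * b `^ a)^-1 * (x `^ (a - 1) * expR (- (b^-1 * x))).
Proof. by move=> x0; rewrite /gamma_pdf x0 mulrA [b^-1 * _]mulrC. Qed.

Lemma gamma_pdf_npos x : x <= 0 -> p x = 0.
Proof. by rewrite leNgt /gamma_pdf => /negbTE ->. Qed.

(** Half of the exponential rate [1 / b] is spent on absorbing the power, which leaves a pure
    exponential with an explicit integral. *)
Lemma weight_tail : exists2 C, 0 < C & forall t, 1 <= t ->
  t `^ (a - 1) * expR (- (b^-1 * t)) <= C * expR (- ((2 * b)^-1 * t)).
Proof.
have c0 : 0 < (2 * b)^-1 by rewrite invr_gt0 mulr_gt0.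
have [C C0 HC] := powR_le_expR (a - 1) c0; exists C => // t t1.
have -> : expR (- ((2 * b)^-1 * t)) =
    expR ((2 * b)^-1 * t) * expR (- (b^-1 * t)).
  by rewrite -expRD; congr expR; field; rewrite gt_eqF.
by rewrite mulrA ler_pM2r ?expR_gt0// HC.
Qed.

Lemma measurable_weight :
  measurable_fun setT (fun t : R => t `^ (a - 1) * expR (- (b^-1 * t))).
Proof.
apply: measurable_funM; first exact: measurable_powR.
by do 2 apply: measurableT_comp => //; exact: measurable_funM.
Qed.

(** The half-line is cut at 1: below, the exponential is at most 1 and the power is integrable;
    above, [weight_tail] dominates. *)
Lemma integrable_weight :
  mu.-integrable `]0, +oo[ (EFin \o (fun t => t `^ (a - 1) * expR (- (b^-1 * t)))).
Proof.
have mf := measurable_weight.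
have mp : measurable_fun setT (fun t : R => t `^ (a - 1)) by exact: measurable_powR.
have mfE (D : set R) : measurable_fun D
    (fun t : R => (t `^ (a - 1) * expR (- (b^-1 * t)))%:E).
  by apply/measurable_EFinP; exact: measurable_funTS.
have f0 t : 0 <= t `^ (a - 1) * expR (- (b^-1 * t)).
  by rewrite mulr_ge0 ?powR_ge0 ?expR_ge0.
apply/integrableP; split; first exact: mfE.
under eq_integral do rewrite /= ger0_norm//.
rewrite (@itv_bndbnd_setU _ _ _ (BRight 1)) ?bnd_simp//.
rewrite integral_setU//; last first.
  apply/disj_setPLR => x /=; rewrite !in_itv/= => /andP[_ x1].
  by rewrite ltNge x1.
  exact: mfE.
apply: lte_add_pinfty.
  apply: (@le_lt_trans _ _ (\int[mu]_(x in `]0%R, 1%R]) (x `^ (a - 1))%:E)%E).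
    apply: ge0_le_integral => //.
    - by move=> x _; rewrite lee_fin.
    - exact: mfE.
    - by apply/measurable_EFinP; apply: measurable_funTS.
    - move=> x; rewrite /= in_itv/= => /andP[x0 x1]; rewrite lee_fin.
      rewrite ler_piMr ?powR_ge0// expR_le1 oppr_le0 mulr_ge0 ?invr_ge0 ?ltW//.
  exact: integrable_lty (integrable_powR01 a_gt0).
have [C C0 HC] := weight_tail.
have mC (D : set R) : measurable_fun D (fun t : R => (expR (- ((2 * b)^-1 * t)))%:E).
  apply/measurable_EFinP; apply: measurable_funTS.
  by do 2 apply: measurableT_comp => //; exact: measurable_funM.
apply: (@le_lt_trans _ _ (\int[mu]_(x in `]1%R, +oo[)
    (C%:E * (expR (- ((2 * b)^-1 * x)))%:E))%E).
  apply: ge0_le_integral => //.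
  - by move=> x _; rewrite lee_fin.
  - exact: mfE.
  - by apply: measurable_funeM; exact: mC.
  - move=> x; rewrite /= in_itv/= andbT => x1; rewrite -EFinM lee_fin.
    by apply: HC; exact: ltW.
rewrite ge0_integralZl//; last 2 first.
  exact: mC.
  by rewrite lee_fin ltW.
rewrite integral_itv_obnd_cbnd// integral_expRN_itvcy ?invr_gt0 ?mulr_gt0//.
by rewrite -EFinM ltry.
Qed.

Lemma integrable_gamma_pdf : mu.-integrable setT (EFin \o p).
Proof.
have H : mu.-integrable `]0, +oo[ (EFin \o p).
  have H := integrableZl _ (Gamma a * b `^ a)^-1 integrable_weight.
  apply: eq_integrable (H (measurable_itv _)) => //= x; rewrite inE/= in_itv/= andbT => x0.
  by rewrite gamma_pdfE.
have {H} : mu.-integrable setT ((EFin \o p) \_ `]0, +oo[).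
  by apply/integrable_restrict => //=; rewrite setTI.
apply: eq_integrable => // x _; rewrite patchE; case: ifPn => //.
rewrite notin_setE/= in_itv/= andbT => /negP; rewrite -leNgt => x0.
by rewrite gamma_pdf_npos.
Qed.

End gamma_law.

Section Gamma_fun.
Context {R : realType}.
Notation mu := (@lebesgue_measure R).

(** On [[1, 2]] the integrand is at least [e^-2 / 2], because [t^(a-1) >= t^-1 >= 1/2] there. This
    makes the normalizing constant of the density invertible. *)
Lemma Gamma_gt0 (a : R) : 0 < a -> 0 < Gamma a.
Proof.
move=> a0; pose c : R := 2^-1 * expR (- 2).
have c0 : 0 < c by rewrite mulr_gt0 ?expR_gt0.
have iG := integrable_weight a0 (@ltr01 R).
rewrite /Gamma.
under eq_Rintegral do rewrite -[X in expR (- X)]mul1r -[X in expR (- (X * _))]invr1.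
apply: (lt_le_trans c0).
rewrite -lee_fin fineK; last exact: integrable_fin_num.
have -> : c%:E = (\int[mu]_(x in `[1%R, 2%R]) (cst c%:E x))%E.
  rewrite integral_cst//= lebesgue_measure_itv/= lte_fin ltr1n/=.
  by rewrite -EFinB -EFinM; congr EFin; ring.
apply: (@le_trans _ _ (\int[mu]_(x in `[1%R, 2%R])
    (x `^ (a - 1) * expR (- (1^-1 * x)))%:E)%E).
  apply: ge0_le_integral => //=.
  - by move=> x _; rewrite lee_fin ltW.
  - by apply/measurable_EFinP; exact: (measurable_funTS (measurable_weight _ _)).
  - move=> x; rewrite in_itv/= => /andP[x1 x2]; rewrite lee_fin.
    rewrite ler_pM ?expR_ge0// ?ler_expR ?invr1 ?mul1r ?lerN2//.
    apply: (@le_trans _ _ (x `^ (-1))).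
      by rewrite powR_inv1 ?lef_pV2 ?posrE; lra.
    by apply: ler_powR => //; lra.
apply: ge0_subset_integral => //=.
- by apply/measurable_EFinP; exact: (measurable_funTS (measurable_weight _ _)).
- by move=> x _; rewrite lee_fin mulr_ge0 ?powR_ge0 ?expR_ge0.
- by move=> x; rewrite /= !in_itv/= => /andP[x1 _]; rewrite andbT; lra.
Qed.

End Gamma_fun.

Section gamma_cdf.
Context {R : realType}.
Notation mu := (@lebesgue_measure R).
Variables (a b : R).
Hypothesis a_gt0 : 0 < a.
Hypothesis b_gt0 : 0 < b.
Local Notation p := (gamma_pdf a b).
Implicit Types (x y : R).

Lemma gamma_pdf_gt0 x : 0 < x -> 0 < p x.
Proof.
move=> x0; rewrite gamma_pdfE// !mulr_gt0 ?expR_gt0 ?powR_gt0//.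
by rewrite invr_gt0 mulr_gt0 ?powR_gt0 ?Gamma_gt0.
Qed.

(** The density is defined by cases, so the derivative is computed on the formula [q], which agrees
    with it near any positive point. The result is put in logarithmic form, a factor times [p x]. *)
Lemma is_derive_gamma_pdf x : 0 < x ->
  is_derive x 1 p (((a - 1) / x - b^-1) * p x).
Proof.
move=> x0; pose c := (Gamma a * b `^ a)^-1.
pose q x := c * (x `^ (a - 1) * expR (- (b^-1 * x))).
have pq : \near x, q x = p x.
  by near=> y; rewrite gamma_pdfE//; near: y; exact: lt_nbhsr.
have dq : is_derive x 1 q (((a - 1) / x - b^-1) * p x).
  rewrite /q; apply: is_derive_eq.
    apply: is_deriveM; apply: is_deriveM; exact: is_derive_powR.
  rewrite gamma_pdfE// /GRing.scale/= -/c.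
  have -> : x `^ (a - 1 - 1) = x `^ (a - 1) / x.
    by rewrite powRB ?powRr1 ?ltW// (gt_eqF x0) implybT.
  by field; rewrite !gt_eqF.
exact: near_eq_is_derive pq dq.
Unshelve. all: by end_near. Qed.

Lemma continuous_gamma_pdf x : 0 < x -> {for x, continuous p}.
Proof. by move=> x0; exact: is_derive_continuous (is_derive_gamma_pdf x0). Qed.

Let intp (D : set R) : measurable D -> mu.-integrable D (EFin \o p).
Proof.
by move=> mD; apply: integrableS (integrable_gamma_pdf a_gt0 b_gt0).
Qed.

Lemma P_lower_ge0 x : 0 <= P_lower a b x.
Proof. by apply: Rintegral_ge0 => y _; exact: gamma_pdf_ge0. Qed.

Lemma P_upper_ge0 x : 0 <= P_upper a b x.
Proof. by apply: Rintegral_ge0 => y _; exact: gamma_pdf_ge0. Qed.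

Lemma P_lower0 : P_lower a b 0 = 0.
Proof. by rewrite /P_lower set_itv1 Rintegral_set1. Qed.

Lemma P_lower_cvg0 : P_lower a b y @[y --> (0 : R)] --> (0 : R).
Proof.
exact: (parameterized_integral_cvg_left ltr01 (intp (measurable_itv _))).
Qed.

Lemma is_derive_P_lower x : 0 < x -> is_derive x 1 (P_lower a b) (p x).
Proof.
move=> x0; have xx1 : x < x + 1 by rewrite ltrDl.
have [dP PE] := continuous_FTC1_closed xx1 (intp (measurable_itv _)) x0
  (continuous_gamma_pdf x0).
by apply: DeriveDef; [exact: dP|rewrite -derive1E].
Qed.

Local Notation mass := (\int[mu]_(x in `[0%R, +oo[) p x).

(** The total mass stays symbolic at this stage: its value 1 is read off directly only for [b = 1]
    and is then transported by scaling. *)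
Lemma P_lowerD_upper_mass x : 0 <= x -> P_lower a b x + P_upper a b x = mass.
Proof.
move=> x0; rewrite /P_upper -Rintegral_itv_obnd_cbnd; last exact: intp.
rewrite -(@Rintegral_itvB _ _ (BLeft 0)) ?bnd_simp//; last exact: intp.
by rewrite addrC subrK.
Qed.

Lemma P_upper_tail : exists2 C, 0 < C &
  forall y, 1 <= y -> P_upper a b y <= C * expR (- ((2 * b)^-1 * y)).
Proof.
have [C C0 HC] := weight_tail a b_gt0.
pose c := (Gamma a * b `^ a)^-1.
have c0 : 0 < c by rewrite invr_gt0 mulr_gt0 ?powR_gt0 ?Gamma_gt0.
exists (c * C * (2 * b)); first by rewrite !mulr_gt0.
move=> y y1; have b20 : 0 < (2 * b)^-1 by rewrite invr_gt0 mulr_gt0.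
have E := integral_expRN_itvcy y b20.
have mE : measurable_fun setT (fun t : R => expR (- ((2 * b)^-1 * t))).
  by do 2 apply: measurableT_comp => //; exact: measurable_funM.
have iE : mu.-integrable `[y, +oo[ (EFin \o (fun t => expR (- ((2 * b)^-1 * t)))).
  apply/integrableP; split.
    by apply/measurable_EFinP; exact: measurable_funTS.
  under eq_integral do rewrite /= ger0_norm ?expR_ge0//.
  by rewrite E ltry.
apply: (@le_trans _ _ (\int[mu]_(t in `[y, +oo[) (c * C * expR (- ((2 * b)^-1 * t))))).
  apply: le_Rintegral => //; first exact: intp.
    have H := integrableZl _ (c * C) iE.
    by apply: eq_integrable (H (measurable_itv _)).
  move=> x; rewrite /= in_itv/= andbT => yx.
  have x1 := le_trans y1 yx; rewrite gamma_pdfE ?(lt_le_trans _ x1)//.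
  by rewrite -/c -mulrA ler_pM2l// HC.
rewrite RintegralZl//= /Rintegral E/= invrK.
by rewrite !mulrA.
Qed.

Lemma P_lower_cvg_mass : P_lower a b y @[y --> +oo%R] --> mass.
Proof.
have [C C0 HC] := P_upper_tail.
suff PU : P_upper a b y @[y --> +oo%R] --> (0 : R).
  have : (mass - P_upper a b y) @[y --> +oo%R] --> mass.
    by rewrite -[X in _ --> X]subr0; apply: cvgB => //; exact: cvg_cst.
  apply: cvg_trans; apply: near_eq_cvg; near=> y.
  have y0 : 0 <= y by near: y; apply: nbhs_pinfty_ge; exact: num_real.
  by rewrite -(P_lowerD_upper_mass y0) addrK.
apply: (@squeeze_cvgr _ _ _ _ (fun=> 0) (fun y => C * expR (- ((2 * b)^-1 * y)))).
- near=> y.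
  have y1 : 1 <= y by near: y; apply: nbhs_pinfty_ge; exact: num_real.
  by rewrite P_upper_ge0/= HC.
- exact: cvg_cst.
- rewrite -[X in _ --> X](mulr0 C); apply: cvgM; first exact: cvg_cst.
  by apply: cvg_expRNM_pinfty; rewrite invr_gt0 mulr_gt0.
Unshelve. all: by end_near. Qed.

End gamma_cdf.

Section gamma_scaling.
Context {R : realType}.
Notation mu := (@lebesgue_measure R).
Variables (a b : R).
Hypothesis a_gt0 : 0 < a.
Hypothesis b_gt0 : 0 < b.

Lemma gamma_pdf_scale x : gamma_pdf a b x = gamma_pdf a 1 (x / b) / b.
Proof.
have [x0|x0] := ltP 0 x; last first.
  rewrite (gamma_pdf_npos _ _ x0) gamma_pdf_npos ?mul0r//.
  by rewrite ler_pdivrMr ?mul0r.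
rewrite !gamma_pdfE ?divr_gt0// powR1 mulr1 invr1 mul1r.
have -> : (x / b) `^ (a - 1) = x `^ (a - 1) / b `^ (a - 1).
  rewrite powRM ?invr_ge0 ?ltW//; congr (_ * _).
  by rewrite -powR_inv1 ?ltW// -powRrM mulN1r powRN.
rewrite -[b `^ a]mulr_powRB1 ?ltW// [b^-1 * x]mulrC.
by field; rewrite !gt_eqF ?powR_gt0 ?Gamma_gt0.
Qed.

End gamma_scaling.

(** * Fundamental theorem of calculus from 0 and up to infinity *)

Section half_line_FTC.
Context {R : realType}.
Notation mu := (@lebesgue_measure R).
Implicit Types (f F d D : R -> R) (x y l m : R).

(** At 0 only right limits are asked for, and derivatives only at positive points: the formulas
    available for the Gamma density hold for positive arguments. *)
Lemma FTC2_itv0 f F x : 0 < x ->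
  (forall y, 0 < y -> {for y, continuous f}) -> f y @[y --> 0^'+] --> f 0 ->
  (forall y, 0 < y -> is_derive y 1 F (f y)) -> F y @[y --> 0^'+] --> F 0 ->
  (\int[mu]_(y in `[0%R, x]) (f y)%:E = (F x - F 0)%:E)%E.
Proof.
move=> x0 cf cf0 dF cF0.
rewrite (@continuous_FTC2 _ f F)//.
- apply/(continuous_within_itvP _ x0); split => //.
    by move=> y; rewrite in_itv/= => /andP[y0 _]; exact: cf.
  by apply: cvg_at_left_filter; exact: cf.
- split => //.
    by move=> y; rewrite in_itv/= => /andP[y0 _]; have [] := dF _ y0.
  by apply: cvg_at_left_filter; exact: is_derive_continuous (dF _ x0).
- move=> y; rewrite in_itv/= => /andP[y0 _]; rewrite derive1E.
  by have [_ ->] := dF _ y0.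
Qed.

Lemma integrable_itv0 f x : 0 < x ->
  (forall y, 0 < y -> {for y, continuous f}) -> f y @[y --> 0^'+] --> f 0 ->
  mu.-integrable `[0, x] (EFin \o f).
Proof.
move=> x0 cf cf0; apply: continuous_compact_integrable; first exact: segment_compact.
apply/(continuous_within_itvP _ x0); split => //.
  by move=> y; rewrite in_itv/= => /andP[y0 _]; exact: cf.
by apply: cvg_at_left_filter; exact: cf.
Qed.

Lemma ge0_FTC2_itvcy f F x l : 0 < x ->
  (forall y, 0 < y -> 0 <= f y) ->
  (forall y, 0 < y -> {for y, continuous f}) ->
  (forall y, 0 < y -> is_derive y 1 F (f y)) ->
  F y @[y --> +oo%R] --> l ->
  (\int[mu]_(y in `[x, +oo[) (f y)%:E = (l - F x)%:E)%E.
Proof.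
move=> x0 f0 cf dF Fl.
rewrite (@ge0_continuous_FTC2y _ f F x l)//.
- by move=> y xy; apply: f0; exact: lt_le_trans xy.
- apply/continuous_within_itvcyP; split.
    by move=> y; rewrite in_itv/= andbT => xy; apply: cf; exact: lt_trans xy.
  by apply: cvg_at_right_filter; exact: cf.
- by move=> y xy; have [] := dF _ (lt_trans x0 xy).
- by apply: cvg_at_right_filter; exact: is_derive_continuous (dF _ x0).
- move=> y; rewrite in_itv/= andbT => xy; rewrite derive1E.
  by have [_ ->] := dF _ (lt_trans x0 xy).
Qed.

Lemma measurable_itvcy f x : 0 < x ->
  (forall y, 0 < y -> {for y, continuous f}) -> measurable_fun `[x, +oo[ f.
Proof.
move=> x0 cf.
have mf : measurable_fun (`]0, +oo[ : set R) f.
  apply: open_continuous_measurable_fun => // y.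
  by rewrite inE/= in_itv/= andbT; exact: cf.
apply: measurable_funS mf => //.
by move=> y; rewrite /= !in_itv/= !andbT; exact: lt_le_trans.
Qed.

Lemma ge0_integrable_itvcy f F x l : 0 < x ->
  (forall y, 0 < y -> 0 <= f y) ->
  (forall y, 0 < y -> {for y, continuous f}) ->
  (forall y, 0 < y -> is_derive y 1 F (f y)) ->
  F y @[y --> +oo%R] --> l ->
  mu.-integrable `[x, +oo[ (EFin \o f).
Proof.
move=> x0 f0 cf dF Fl; apply/integrableP; split.
  by apply/measurable_EFinP; exact: measurable_itvcy.
rewrite (_ : \int[mu]_(y in _) _ = \int[mu]_(y in `[x, +oo[) (f y)%:E)%E.
  by rewrite (ge0_FTC2_itvcy x0 f0 cf dF Fl) ltry.
apply: eq_integral => y; rewrite inE/= in_itv/= andbT => xy.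
by rewrite ger0_norm// f0// (lt_le_trans x0 xy).
Qed.

(* The library FTC on a half-line is for functions of constant sign; it is
   applied here to f + d and d. *)
Lemma dominated_FTC2_itvcy f F d D x l m : 0 < x ->
  (forall y, 0 < y -> {for y, continuous f}) ->
  (forall y, 0 < y -> is_derive y 1 F (f y)) -> F y @[y --> +oo%R] --> l ->
  (forall y, 0 < y -> `|f y| <= d y) ->
  (forall y, 0 < y -> {for y, continuous d}) ->
  (forall y, 0 < y -> is_derive y 1 D (d y)) -> D y @[y --> +oo%R] --> m ->
  mu.-integrable `[x, +oo[ (EFin \o f) /\
  \int[mu]_(y in `[x, +oo[) f y = l - F x.
Proof.
move=> x0 cf dF Fl fd cd dD Dm.
have d0 y : 0 < y -> 0 <= d y by move=> y0; exact: le_trans (fd _ y0).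
have fd0 y : 0 < y -> 0 <= (f \+ d) y.
  by move=> y0; have := fd _ y0; rewrite ler_norml /=; lra.
have cfd y : 0 < y -> {for y, continuous (f \+ d)}.
  by move=> y0; apply: cvgD; [exact: cf|exact: cd].
have dFD y : 0 < y -> is_derive y 1 (F \+ D) ((f \+ d) y).
  by move=> y0; apply: is_deriveD; [exact: dF|exact: dD].
have FDl : (F \+ D) y @[y --> +oo%R] --> l + m by apply: cvgD.
have id_ := ge0_integrable_itvcy x0 d0 cd dD Dm.
have ifd := ge0_integrable_itvcy x0 fd0 cfd dFD FDl.
have if_ : mu.-integrable `[x, +oo[ (EFin \o f).
  have H := integrableB _ ifd id_.
  apply: eq_integrable (H (measurable_itv _)) => //= y _.
  by rewrite -EFinB addrK.
split => //.
have H := RintegralB _ ifd id_; have {H} := H (measurable_itv _).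
under eq_Rintegral do rewrite /= addrK.
move=> ->; rewrite /Rintegral (ge0_FTC2_itvcy x0 fd0 cfd dFD FDl).
by rewrite (ge0_FTC2_itvcy x0 d0 cd dD Dm)/=; ring.
Qed.

End half_line_FTC.

(** * Total mass one, and decay at 0 and at infinity *)

Section gamma_mass.
Context {R : realType}.
Notation mu := (@lebesgue_measure R).
Variables (a b : R).
Hypothesis a_gt0 : 0 < a.
Hypothesis b_gt0 : 0 < b.
Implicit Types (x y : R).

(** In place of a change of variables: the difference [F] of the two sides has derivative 0 on the
    positive reals and tends to 0 at 0, so integrating the zero function gives [F x = 0]. *)
Lemma P_lower_scale x : 0 < x -> P_lower a b x = P_lower a 1 (x / b).
Proof.
move=> x0; pose F y := P_lower a b y - P_lower a 1 (y / b).
have b1 y : 0 < y -> 0 < y / b by move=> y0; rewrite divr_gt0.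
have dF y : 0 < y -> is_derive y 1 F (cst 0 y).
  move=> y0; rewrite /F; apply: is_derive_eq.
    apply: is_deriveB; first exact: is_derive_P_lower.
    apply: (is_derive1_comp (f := P_lower a 1) (g := fun y => y / b)).
    by apply: is_derive_P_lower => //; exact: b1.
  by rewrite /GRing.scale/= gamma_pdf_scale// !(mulr0,addr0,add0r,mulr1) ?subrr.
have F0 : F 0 = 0 by rewrite /F mul0r !P_lower0 subrr.
have cF : F y @[y --> 0^'+] --> F 0.
  rewrite F0 -[X in _ --> X](subr0 (0 : R)); apply: cvg_at_right_filter; apply: cvgB.
    exact: P_lower_cvg0.
  have yb : y / b @[y --> (0 : R)] --> (0 : R).
    by rewrite -[X in _ --> X](mul0r b^-1); apply: cvgM; [exact: cvg_id|exact: cvg_cst].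
  by apply: cvg_comp yb _; exact: P_lower_cvg0.
have c0 y : 0 < y -> {for y, continuous (cst 0 : R -> R)}.
  by move=> _; exact: cvg_cst.
have := FTC2_itv0 x0 c0 (cvg_cst _) dF cF.
rewrite integral0 F0 subr0 => E.
have /eqP : F x = 0 by apply/EFin_inj; rewrite -E.
by rewrite /F subr_eq0 => /eqP.
Qed.

Lemma mass_gamma1 : \int[mu]_(x in `[0%R, +oo[) gamma_pdf a 1 x = 1.
Proof.
have ip : mu.-integrable `]0, +oo[ (EFin \o gamma_pdf a 1).
  by apply: integrableS (integrable_gamma_pdf a_gt0 (@ltr01 R)).
rewrite -Rintegral_itv_obnd_cbnd//.
transitivity (\int[mu]_(t in `]0%R, +oo[)
    ((Gamma a)^-1 * (t `^ (a - 1) * expR (- (1^-1 * t))))).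
  apply: eq_Rintegral => t; rewrite inE/= in_itv/= andbT => t0.
  by rewrite gamma_pdfE// powR1 mulr1.
rewrite RintegralZl//; last exact: integrable_weight.
under eq_Rintegral do rewrite invr1 mul1r.
by rewrite mulVf// gt_eqF// Gamma_gt0.
Qed.

(** As [y] grows, [P_lower a b y] tends to the mass for [b], and [P_lower a 1 (y / b)] to the mass
    for 1; the two functions coincide by scaling. *)
Lemma mass_gamma : \int[mu]_(x in `[0%R, +oo[) gamma_pdf a b x = 1.
Proof.
rewrite -mass_gamma1.
have H := P_lower_cvg_mass a_gt0 b_gt0.
have H1 : P_lower a 1 (y / b) @[y --> +oo%R] -->
    \int[mu]_(x in `[0%R, +oo[) gamma_pdf a 1 x.
  apply: (@cvg_comp _ _ _ (fun y => y / b) (P_lower a 1) _ +oo%R).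
    by apply: gt0_cvgMly; rewrite ?invr_gt0//; exact: cvg_id.
  exact: P_lower_cvg_mass.
have H2 : P_lower a b y @[y --> +oo%R] -->
    \int[mu]_(x in `[0%R, +oo[) gamma_pdf a 1 x.
  apply: cvg_trans H1; apply: near_eq_cvg; near=> y.
  have y0 : 0 < y by near: y; apply: nbhs_pinfty_gt; exact: num_real.
  by rewrite P_lower_scale.
exact: cvg_unique H H2.
Unshelve. all: by end_near. Qed.

Lemma P_lowerD_upper x : 0 <= x -> P_lower a b x + P_upper a b x = 1.
Proof. by move=> x0; rewrite P_lowerD_upper_mass// mass_gamma. Qed.

(** With total mass 1, the upper tail is [1 - P_lower] on the positive reals, and the derivative of
    [P_lower] is known. *)
Lemma is_derive_P_upper x : 0 < x -> is_derive x 1 (P_upper a b) (- gamma_pdf a b x).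
Proof.
move=> x0.
have Pq : \near x, 1 - P_lower a b x = P_upper a b x.
  near=> y; have y0 : 0 < y by near: y; exact: lt_nbhsr.
  by rewrite -(P_lowerD_upper (ltW y0)) addrC addKr.
have dq : is_derive x 1 (fun x => 1 - P_lower a b x) (- gamma_pdf a b x).
  rewrite -[X in is_derive _ _ _ X]sub0r; apply: is_deriveB.
  exact: is_derive_P_lower.
exact: near_eq_is_derive Pq dq.
Unshelve. all: by end_near. Qed.

Lemma gamma_pdf_decay (m : nat) : y ^+ m * gamma_pdf a b y @[y --> +oo%R] --> (0 : R).
Proof.
have H : (Gamma a * b `^ a)^-1 * (y `^ (m%:R + (a - 1)) * expR (- (b^-1 * y)))
    @[y --> +oo%R] --> (0 : R).
  rewrite -[X in _ --> X](mulr0 (Gamma a * b `^ a)^-1).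
  apply: cvgM; first exact: cvg_cst.
  by apply: cvg_powR_expRN_pinfty; rewrite invr_gt0.
apply: cvg_trans H; apply: near_eq_cvg; near=> y.
have y0 : 0 < y by near: y; apply: nbhs_pinfty_gt; exact: num_real.
rewrite gamma_pdfE//.
have -> : y `^ (m%:R + (a - 1)) = y ^+ m * y `^ (a - 1).
  by rewrite (@powRD _ y m%:R) ?(gt_eqF y0) ?implybT// powR_mulrn// ltW.
by ring.
Unshelve. all: by end_near. Qed.

Lemma P_upper_decay (m : nat) : y ^+ m * P_upper a b y @[y --> +oo%R] --> (0 : R).
Proof.
have [C C0 HC] := P_upper_tail a_gt0 b_gt0.
apply: (@squeeze_cvgr _ _ _ _ (fun=> 0)
  (fun y => C * (y `^ m%:R * expR (- ((2 * b)^-1 * y))))).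
- near=> y.
  have y1 : 1 <= y by near: y; apply: nbhs_pinfty_ge; exact: num_real.
  have y0 : 0 <= y by exact: le_trans y1.
  rewrite powR_mulrn// mulr_ge0 ?exprn_ge0 ?P_upper_ge0//=.
  by rewrite mulrCA ler_wpM2l ?exprn_ge0 ?HC.
- exact: cvg_cst.
- rewrite -[X in _ --> X](mulr0 C); apply: cvgM; first exact: cvg_cst.
  by apply: cvg_powR_expRN_pinfty; rewrite invr_gt0 mulr_gt0.
Unshelve. all: by end_near. Qed.

(** The density itself may blow up at 0; the extra factor turns [y^(a-1)] into [y^a], which vanishes
    because [a] is positive. *)
Lemma gamma_pdf_mulx_cvg0 : y * gamma_pdf a b y @[y --> 0^'+] --> (0 : R).
Proof.
have H : (Gamma a * b `^ a)^-1 * (y `^ a * expR (- (b^-1 * y)))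
    @[y --> 0^'+] --> (0 : R).
  rewrite -[X in _ --> X](mulr0 (Gamma a * b `^ a)^-1).
  apply: cvgM; first exact: cvg_cst.
  rewrite -[X in _ --> X](mul0r (expR (- (b^-1 * 0)))).
  apply: cvgM; first exact: powR_cvg0.
  apply: cvg_at_right_filter.
  apply: (@continuous_comp _ _ _ (fun t => - (b^-1 * t)) expR); last exact: continuous_expR.
  by apply: cvgN; apply: cvgM; [exact: cvg_cst|exact: cvg_id].
apply: cvg_trans H; apply: near_eq_cvg; near=> y.
have y0 : 0 < y by near: y; exact: nbhs_right_gt.
by rewrite gamma_pdfE// -(mulr_powRB1 (ltW y0) a_gt0); ring.
Unshelve. all: by end_near. Qed.

End gamma_mass.

Lemma P_upper_scale {R : realType} (a b x : R) : 0 < a -> 0 < b -> 0 < x ->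
  P_upper a b x = P_upper a 1 (x / b).
Proof.
move=> a0 b0 x0; have xb : 0 < x / b by rewrite divr_gt0.
have := P_lowerD_upper a0 b0 (ltW x0).
have := P_lowerD_upper a0 (@ltr01 R) (ltW xb).
by rewrite -P_lower_scale//; lra.
Qed.

(** * Iterated integrals of the distribution function *)

Section iterated_integrals.
Context {R : realType}.
Notation mu := (@lebesgue_measure R).
Variables (a b : R).
Hypothesis a_gt0 : 0 < a.
Hypothesis b_gt0 : 0 < b.
Local Notation p := (gamma_pdf a b).
Implicit Types (sg : R) (F : R -> R) (k : nat) (x y : R).

(** One encoding for both families: [sg = 1] with [F = P] gives the [A_k], [sg = -1] with
    [F = 1 - P] gives the [B_k]. Indices are shifted by one, so that index 0 is the density and
    index [k + 1] the [k]-fold integral. The recurrence is the definition; that these functions are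
    iterated integrals is proved later, from their derivatives and limits. *)
Fixpoint itint sg F k y : R :=
  match k with
  | 0 => p y
  | k1.+1 => match k1 with
    | 0 => F y
    | k2.+1 => (b * y * itint sg F k2 y
                + sg * (y - a * b - k2%:R * b) * itint sg F k1 y) / k1%:R
    end
  end.

Lemma itintSS sg F k y : itint sg F k.+2 y =
  (b * y * itint sg F k y + sg * (y - a * b - k%:R * b) * itint sg F k.+1 y)
  / k.+1%:R.
Proof. by []. Qed.

(** The recurrence involves two earlier indices, so two consecutive derivatives are carried through
    the induction. Differentiating the recurrence for one index reproduces the recurrence for the
    previous one, recorded as [E]. *)
Lemma is_derive_itint sg F k y : sg * sg = 1 ->
  (forall x, 0 < x -> is_derive x 1 F (sg * p x)) -> 0 < y ->
  is_derive y 1 (itint sg F k.+1) (sg * itint sg F k y).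
Proof.
move=> sg1 dF y0.
suff [] : is_derive y 1 (itint sg F k.+1) (sg * itint sg F k y) /\
          is_derive y 1 (itint sg F k.+2) (sg * itint sg F k.+1 y) by [].
elim: k => [|k [IH1 IH2]].
  split; first exact: dF.
  rewrite (_ : itint sg F 2 = fun y => b * y * p y + sg * (y - a * b) * F y); last first.
    by apply/funext => x; rewrite itintSS mul0r subr0 divr1.
  have dp := is_derive_gamma_pdf a b_gt0 y0.
  have dFy := dF _ y0.
  apply: is_derive_eq.
  rewrite /GRing.scale/=.
  rewrite !mulr1.
  have -> : sg * (y - a * b) * (sg * p y) = (sg * sg) * (y - a * b) * p y by ring.
  by rewrite sg1; field; rewrite !gt_eqF.
split => //.
rewrite (_ : itint sg F k.+3 = fun y => (b * y * itint sg F k.+1 y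
    + sg * (y - a * b - k.+1%:R * b) * itint sg F k.+2 y) * k.+2%:R^-1); last first.
  by apply/funext => x; rewrite itintSS.
have E : k.+1%:R * itint sg F k.+2 y = 
  b * y * itint sg F k y + sg * (y - a * b - k%:R * b) * itint sg F k.+1 y.
  by rewrite itintSS mulrC divfK// pnatr_eq0.
move: E IH1 IH2.
move: (itint sg F k) (itint sg F k.+1) (itint sg F k.+2) => T0 T1 T2 E IH1 IH2.
apply: is_derive_eq.
rewrite /GRing.scale/= mulr0 mulr0 add0r !mulr1 !subr0 mulr1.
(* The relation [sg * sg = 1] is invisible to [ring], hence the explicit remainder with factor
   [1 - sg * sg]. *)
have -> : b * y * (sg * T0 y) + T1 y * b +
    (sg * (y - a * b - k.+1%:R * b) * (sg * T1 y) + T2 y * sg)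
  = sg * (b * y * T0 y + sg * (y - a * b - k%:R * b) * T1 y) + sg * T2 y
    + (1 - sg * sg) * b * T1 y.
  by rewrite -natr1; ring.
rewrite sg1 subrr !mul0r addr0 -E.
by rewrite -[k.+2%:R]natr1; field; rewrite nat1r natr1 pnatr_eq0.
Qed.

(** Up to a constant the [k]-th derivative is [itint (k+1) / q] with [q = p x^(k+1)]. The
    logarithmic derivative of [q] is [(a b + k b - y) / (b y)], so the quotient rule produces
    exactly the numerator of the recurrence, that is [(k + 1) itint (k+2)]. *)
Lemma derive1n_itint_ratio sg F k y : sg * sg = 1 ->
  (forall x, 0 < x -> is_derive x 1 F (sg * p x)) -> 0 < y ->
  derive1n k (fun x => F x / (b * x * p x)) y =
  sg ^+ k * k`!%:R * itint sg F k.+1 y / (b * y * p y * (b * y) ^+ k).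
Proof.
move=> sg1 dF; elim: k y => [|k IH] y y0.
  by rewrite derive1n0 fact0 expr0 !expr0 !mul1r mulr1.
rewrite derive1nS derive1E.
pose q x := p x * x ^+ k.+1.
pose c := sg ^+ k * k`!%:R / b ^+ k.+1.
have E x : 0 < x -> sg ^+ k * k`!%:R * itint sg F k.+1 x / (b * x * p x * (b * x) ^+ k) =
    c * (itint sg F k.+1 x * (q x)^-1).
  move=> x0; have px := gamma_pdf_gt0 a_gt0 b_gt0 x0.
  by rewrite /c /q exprMn !exprS; field; rewrite !expf_neq0 ?gt_eqF.
have fg : \near y, c * (itint sg F k.+1 y * (q y)^-1) =
    derive1n k (fun x => F x / (b * x * p x)) y.
  near=> x; have x0 : 0 < x by near: x; exact: lt_nbhsr.
  by rewrite IH// E.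
rewrite -(near_eq_derive _ fg).
have dp := is_derive_gamma_pdf a b_gt0 y0.
have dT := is_derive_itint k sg1 dF y0.
have py := gamma_pdf_gt0 a_gt0 b_gt0 y0.
have q0 : q y != 0 by rewrite mulf_neq0 ?expf_neq0 ?gt_eqF.
have dq : is_derive y 1 q (((a - 1) / y - b^-1 + k.+1%:R / y) * q y).
  have dX : is_derive y 1 (fun x => x ^+ k.+1) (k.+1%:R * y ^+ k).
    apply: DeriveDef; first exact: exprn_derivable.
    by rewrite exp_derive /= /GRing.scale/= mulr1.
  have dpX : is_derive y 1 q _ := is_deriveM dp dX.
  apply: (is_derive_eq dpX).
  rewrite /q /GRing.scale/= exprS.
  by field; rewrite !gt_eqF.
have dqV : is_derive y 1 (fun x => (q x)^-1)
    (- (((a - 1) / y - b^-1 + k.+1%:R / y) / q y)).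
  have [dq1 dq2] := dq; apply: DeriveDef; first exact: derivableV.
  rewrite deriveV// dq2 /GRing.scale/=.
  move: (_ / y - _ + _) (q y) q0 => e Q Q0.
  by field; rewrite Q0.
have [_ D] : is_derive y 1 (fun x => c * (itint sg F k.+1 x * (q x)^-1))
    (c * (itint sg F k.+1 y * (- (((a - 1) / y - b^-1 + k.+1%:R / y) / q y))
      + (q y)^-1 * (sg * itint sg F k y))).
  by apply: is_deriveZ; exact: (is_deriveM dT dqV).
apply: etrans D _.
rewrite itintSS.
move: (itint sg F k) (itint sg F k.+1) => T0 T1.
rewrite /q /c factS natrM exprMn !exprS.
have -> : k.+1%:R = k%:R + 1 :> R by rewrite natr1.
have k1 : k%:R + 1 != 0 :> R by rewrite natr1 pnatr_eq0.
have bk : b ^+ k != 0 by rewrite expf_neq0 ?gt_eqF.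
have yk : y ^+ k != 0 by rewrite expf_neq0 ?gt_eqF.
transitivity (sg ^+ k * k`!%:R * (b * y * sg * T0 y + (sg * sg) *
  (y - a * b - k%:R * b) * T1 y) / (b * y * p y * (b * y * (b ^+ k * y ^+ k)))).
  by rewrite sg1; field; rewrite bk yk !gt_eqF.
by field; rewrite bk yk k1 !gt_eqF.
Unshelve. all: by end_near.
Qed.
End iterated_integrals.

Section gamma_iterated.
Context {R : realType}.
Notation mu := (@lebesgue_measure R).
Variables (a b : R).
Hypothesis a_gt0 : 0 < a.
Hypothesis b_gt0 : 0 < b.
Local Notation p := (gamma_pdf a b).
Local Notation P := (P_lower a b).
Local Notation Q := (P_upper a b).
Implicit Types (k m : nat) (x y : R).

Definition lower_itint k : R -> R := itint a b 1 P k.+1.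
Definition upper_itint k : R -> R := itint a b (-1) Q k.+1.
Local Notation A := lower_itint.
Local Notation B := upper_itint.

Lemma is_derive_lower_itint k y : 0 < y -> is_derive y 1 (A k.+1) (A k y).
Proof.
move=> y0.
have dP x : 0 < x -> is_derive x 1 P (1 * p x).
  by move=> x0; rewrite mul1r; exact: is_derive_P_lower.
by have := is_derive_itint b_gt0 k.+1 (mulr1 1) dP y0; rewrite mul1r.
Qed.

Lemma is_derive_upper_itint k y : 0 < y -> is_derive y 1 (B k.+1) (- B k y).
Proof.
move=> y0; have sg1 : -1 * -1 = 1 :> R by rewrite mulrNN mulr1.
have dQ x : 0 < x -> is_derive x 1 Q (-1 * p x).
  by move=> x0; rewrite mulN1r; exact: is_derive_P_upper.
by have := is_derive_itint b_gt0 k.+1 sg1 dQ y0; rewrite mulN1r.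
Qed.

Lemma continuous_lower_itint k y : 0 < y -> {for y, continuous (A k)}.
Proof.
move=> y0; case: k => [|k]; last exact: is_derive_continuous (is_derive_lower_itint k y0).
exact: is_derive_continuous (is_derive_P_lower a_gt0 b_gt0 y0).
Qed.

Lemma continuous_upper_itint k y : 0 < y -> {for y, continuous (B k)}.
Proof.
move=> y0; case: k => [|k]; last exact: is_derive_continuous (is_derive_upper_itint k y0).
exact: is_derive_continuous (is_derive_P_upper a_gt0 b_gt0 y0).
Qed.

Lemma lower_itint0 k : A k 0 = 0.
Proof.
rewrite /lower_itint; elim: k => [|k IH]; first exact: P_lower0.
by rewrite itintSS IH !mulr0 mul0r addr0 mul0r.
Qed.

(** The induction starts at the density, which need not have a limit at 0. The recurrence uses the
    older term only multiplied by [y], and that product does tend to 0. *)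
Lemma lower_itint_cvg0 k : A k y @[y --> 0^'+] --> (0 : R).
Proof.
suff [] : (y * itint a b 1 P k y @[y --> 0^'+] --> (0 : R)) /\
  (itint a b 1 P k.+1 y @[y --> 0^'+] --> (0 : R)) by [].
elim: k => [|k [IH1 IH2]].
  split; first exact: gamma_pdf_mulx_cvg0.
  by apply: cvg_at_right_filter; exact: P_lower_cvg0.
have yc : y @[y --> (0 : R)^'+] --> (0 : R) by apply: cvg_at_right_filter; exact: cvg_id.
split; first by rewrite -[X in _ --> X](mulr0 (0 : R)); apply: cvgM.
have E : (b * 0 + 1 * (0 - a * b - k%:R * b) * 0) / k.+1%:R = 0 :> R.
  by rewrite !mulr0 addr0 mul0r.
rewrite -[X in _ --> X]E.
rewrite (_ : itint a b 1 P k.+2 = fun y => (b * (y * itint a b 1 P k y) +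
   1 * (y - a * b - k%:R * b) * itint a b 1 P k.+1 y) / k.+1%:R); last first.
  by apply/funext => y; rewrite itintSS mulrA.
apply: cvgM; last exact: cvg_cst.
apply: cvgD; first by apply: cvgM => //; exact: cvg_cst.
apply: cvgM => //; apply: cvgM; first exact: cvg_cst.
by apply: cvgB; [apply: cvgB => //|]; exact: cvg_cst.
Qed.

(** Each step of the recurrence multiplies by [y], so the induction must cover all powers [m] at
    once. *)
Lemma upper_itint_decay k m : y ^+ m * B k y @[y --> +oo%R] --> (0 : R).
Proof.
suff [] : (forall m, y ^+ m * itint a b (-1) Q k y @[y --> +oo%R] --> (0 : R)) /\
  (forall m, y ^+ m * itint a b (-1) Q k.+1 y @[y --> +oo%R] --> (0 : R)).
  by move=> _ /(_ m).
elim: k => [|k [IH1 IH2]] {m}.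
  by split => m; [exact: gamma_pdf_decay|exact: P_upper_decay].
split => // m.
have E : (b * 0 + (-1) * (0 - (a * b + k%:R * b) * 0)) / k.+1%:R = 0 :> R.
  by rewrite !mulr0 subr0 mulr0 addr0 mul0r.
rewrite -[X in _ --> X]E.
rewrite (_ : (fun y => y ^+ m * itint a b (-1) Q k.+2 y) =
   fun y => (b * (y ^+ m.+1 * itint a b (-1) Q k y) +
   (-1) * (y ^+ m.+1 * itint a b (-1) Q k.+1 y -
     (a * b + k%:R * b) * (y ^+ m * itint a b (-1) Q k.+1 y))) / k.+1%:R); last first.
  by apply/funext => y; rewrite itintSS exprS; ring.
apply: cvgM; last exact: cvg_cst.
apply: cvgD; first by apply: cvgM => //; exact: cvg_cst.
apply: cvgM; first exact: cvg_cst.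
apply: cvgB => //; apply: cvgM => //; exact: cvg_cst.
Qed.

(** [A (k+1)] is a primitive of [A k] and vanishes at 0: this ties the recurrence to genuine
    iterated integrals. *)
Lemma lower_itintS k y : 0 <= y -> \int[mu]_(x in `[0, y]) A k x = A k.+1 y.
Proof.
rewrite le_eqVlt => /predU1P[<-|y0].
  by rewrite set_itv1 Rintegral_set1 lower_itint0.
have cA0 j : A j x @[x --> 0^'+] --> A j 0.
  by rewrite lower_itint0; exact: lower_itint_cvg0.
have := FTC2_itv0 y0 (@continuous_lower_itint k) (cA0 k)
  (@is_derive_lower_itint k) (cA0 k.+1).
by rewrite /Rintegral => ->; rewrite lower_itint0 subr0.
Qed.

Lemma lower_itint_ge0 k y : 0 <= y -> 0 <= A k y.
Proof.
elim: k y => [|k IH] y y0; first exact: P_lower_ge0.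
rewrite -lower_itintS//; apply: Rintegral_ge0 => x.
by rewrite /= in_itv/= => /andP[x0 _]; exact: IH.
Qed.

Let dNB k y : 0 < y -> is_derive y 1 (fun x => - B k.+1 x) (B k y).
Proof.
move=> y0; rewrite -[X in is_derive _ _ _ X]opprK.
by apply: is_deriveN; exact: is_derive_upper_itint.
Qed.

Let cvgNB k : - B k y @[y --> +oo%R] --> (0 : R).
Proof.
rewrite -[X in _ --> X]oppr0; apply: cvgN.
have := upper_itint_decay k 0; apply: cvg_trans; apply: near_eq_cvg.
by near=> y; rewrite expr0 mul1r.
Unshelve. all: by end_near. Qed.

(** The two claims are proved together: the half-line theorem asks for a nonnegative integrand, and
    [B (k+1)] is nonnegative because it is the integral of [B k]. *)
Lemma upper_itintS_ge0 k y : 0 < y ->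
  \int[mu]_(x in `[y, +oo[) B k x = B k.+1 y /\ 0 <= B k y.
Proof.
elim: k y => [|k IH] y y0.
  have Q0 x : 0 <= B 0 x by exact: P_upper_ge0.
  split => //.
  have := ge0_FTC2_itvcy y0 (fun x _ => Q0 x) (@continuous_upper_itint 0) (@dNB 0) (cvgNB 1).
  by rewrite /Rintegral => ->; rewrite sub0r opprK.
have B0 x : 0 < x -> 0 <= B k.+1 x.
  move=> x0; have [<- _] := IH _ x0; apply: Rintegral_ge0 => z.
  rewrite /= in_itv/= andbT => xz.
  by have [] := IH z (lt_le_trans x0 xz).
split; last exact: B0.
have := ge0_FTC2_itvcy y0 B0 (@continuous_upper_itint k.+1) (@dNB k.+1) (cvgNB k.+2).
by rewrite /Rintegral => ->; rewrite sub0r opprK.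
Qed.

Lemma upper_itintS k y : 0 < y -> \int[mu]_(x in `[y, +oo[) B k x = B k.+1 y.
Proof. by move=> /(upper_itintS_ge0 k)[]. Qed.

Lemma upper_itint_ge0 k y : 0 < y -> 0 <= B k y.
Proof. by move=> /(upper_itintS_ge0 k)[]. Qed.

Lemma integrable_upper_itint k y : 0 < y -> mu.-integrable `[y, +oo[ (EFin \o B k).
Proof.
move=> y0.
exact: (ge0_integrable_itvcy y0 (@upper_itint_ge0 k) (@continuous_upper_itint k)
  (@dNB k) (cvgNB k.+1)).
Qed.

Lemma integrable_lower_itint k y : 0 < y -> mu.-integrable `[0, y] (EFin \o A k).
Proof.
move=> y0; apply: integrable_itv0 => //.
  by move=> x; exact: continuous_lower_itint.
by rewrite lower_itint0; exact: lower_itint_cvg0.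
Qed.

Lemma P1_lowerE y : 0 <= y -> P1_lower a b y = A 1 y.
Proof. exact: (@lower_itintS 0). Qed.

Lemma P1_upperE y : 0 < y -> P1_upper a b y = B 1 y.
Proof. exact: (@upper_itintS 0). Qed.

Lemma derive1n_M_lower k y : 0 < y -> derive1n k (M_lower a b) y =
  k`!%:R * A k y / (b * y * p y * (b * y) ^+ k).
Proof.
move=> y0.
have dP x : 0 < x -> is_derive x 1 P (1 * p x).
  by move=> x0; rewrite mul1r; exact: is_derive_P_lower.
by have := derive1n_itint_ratio a_gt0 b_gt0 k (mulr1 1) dP y0; rewrite expr1n mul1r.
Qed.

Lemma derive1n_M_upper k y : 0 < y -> derive1n k (M_upper a b) y =
  (-1) ^+ k * (k`!%:R * B k y / (b * y * p y * (b * y) ^+ k)).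
Proof.
move=> y0; have sg1 : -1 * -1 = 1 :> R by rewrite mulrNN mulr1.
have dQ x : 0 < x -> is_derive x 1 Q (-1 * p x).
  by move=> x0; rewrite mulN1r; exact: is_derive_P_upper.
by have := derive1n_itint_ratio a_gt0 b_gt0 k sg1 dQ y0; rewrite !mulrA.
Qed.

(* The two recurrences make the terms in A k * B k cancel. *)
Lemma itint_cross k y : 0 < y ->
  k.+1`!%:R * (B k.+1 y * A k y + A k.+1 y * B k y) = b * y * p y * (b * y) ^+ k.
Proof.
move=> y0; elim: k => [|k IH].
  rewrite /lower_itint /upper_itint !itintSS /= expr0 !mulr1 (_ : 1`! = 1%N :> nat)//.
  (* In the base case the terms in [y - a b] cancel, and total mass 1 evaluates what is left. *)
  have E : b * y * p y = b * y * p y * (P y + Q y).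
    by rewrite (P_lowerD_upper a_gt0 b_gt0 (ltW y0)) mulr1.
  by rewrite [RHS]E; field.
rewrite exprS [RHS]mulrCA -IH factS natrM.
have -> : A k.+2 y = (b * y * A k y + 1 * (y - a * b - k.+1%:R * b) * A k.+1 y)
  / k.+2%:R by exact: itintSS.
have -> : B k.+2 y = (b * y * B k y + -1 * (y - a * b - k.+1%:R * b) * B k.+1 y)
  / k.+2%:R by exact: itintSS.
by field; rewrite -natrD pnatr_eq0.
Qed.

(** The minus sign in [C1] compensates the negative derivative of [M_upper], so the two summands are
    equal. *)
Lemma C1E y : 0 < y -> C1 a b y = 2 * (A 1 y * B 1 y) / (b * y * p y * (b * y)).
Proof.
move=> y0; rewrite /C1 P1_lowerE ?P1_upperE ?ltW//.
rewrite derive1n_M_lower// derive1n_M_upper// !expr1 (_ : 1`! = 1%N :> nat)// !mul1r mulN1r opprK.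
by ring.
Qed.

Lemma C2E y : 0 < y -> C2 a b y =
  2 * (B 2 y * A 2 y + A 2 y * B 2 y) / (b * y * p y * (b * y) ^+ 2).
Proof.
move=> y0; rewrite /C2 derive1n_M_lower// derive1n_M_upper//.
have -> : \int[mu]_(x in `[0, y]) P1_lower a b x = A 2 y.
  rewrite -lower_itintS ?ltW//; apply: eq_Rintegral => x.
  by rewrite inE/= in_itv/= => /andP[x0 _]; exact: P1_lowerE.
have -> : \int[mu]_(x in `[y, +oo[) P1_upper a b x = B 2 y.
  rewrite -upper_itintS//; apply: eq_Rintegral => x.
  by rewrite inE/= in_itv/= andbT => yx; apply: P1_upperE; exact: lt_le_trans yx.
by rewrite sqrrN expr1n (_ : 2`! = 2%N :> nat)//; ring.
Qed.

End gamma_iterated.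

(** * Scaling and finiteness of the constants *)

Section itint_scaling.
Context {R : realType}.
Variables (a b : R).
Hypothesis a_gt0 : 0 < a.
Hypothesis b_gt0 : 0 < b.

(** Because of the index shift, index [k] scales like [b^(k-1)]; the factor [b] on the left avoids a
    negative exponent at the density. *)
Lemma itint_scale sg (F G : R -> R) k y : F y = G (y / b) ->
  b * itint a b sg F k y = b ^+ k * itint a 1 sg G k (y / b).
Proof.
move=> FG.
suff [] : b * itint a b sg F k y = b ^+ k * itint a 1 sg G k (y / b) /\
  b * itint a b sg F k.+1 y = b ^+ k.+1 * itint a 1 sg G k.+1 (y / b) by [].
elim: k => [|k [IH1 IH2]].
  split; last by rewrite /= FG.
  by rewrite /= gamma_pdf_scale// expr0 mul1r; field; rewrite gt_eqF.
split => //; rewrite !itintSS mulrA mulrDr.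
have -> : b * (b * y * itint a b sg F k y) = b * y * (b * itint a b sg F k y) by ring.
have -> : b * (sg * (y - a * b - k%:R * b) * itint a b sg F k.+1 y) =
  sg * (y - a * b - k%:R * b) * (b * itint a b sg F k.+1 y) by ring.
rewrite IH1 IH2 !exprS.
by field; rewrite nat1r pnatr_eq0 (gt_eqF b_gt0).
Qed.

Lemma lower_itint_scale k y : 0 < y ->
  lower_itint a b k y = b ^+ k * lower_itint a 1 k (y / b).
Proof.
move=> y0; apply: (mulfI (lt0r_neq0 b_gt0)).
by rewrite mulrA -exprS; apply: itint_scale; exact: P_lower_scale.
Qed.

Lemma upper_itint_scale k y : 0 < y ->
  upper_itint a b k y = b ^+ k * upper_itint a 1 k (y / b).
Proof.
move=> y0; apply: (mulfI (lt0r_neq0 b_gt0)).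
by rewrite mulrA -exprS; apply: itint_scale; exact: P_upper_scale.
Qed.

Lemma C1_scale y : 0 < y -> C1 a b y = C1 a 1 (y / b) / b.
Proof.
move=> y0; have yb0 : 0 < y / b by rewrite divr_gt0.
have p0 := gamma_pdf_gt0 a_gt0 (@ltr01 R) yb0.
rewrite !C1E// lower_itint_scale// upper_itint_scale// gamma_pdf_scale//.
by field; rewrite !gt_eqF.
Qed.

Lemma C2_scale y : 0 < y -> C2 a b y = C2 a 1 (y / b) / b.
Proof.
move=> y0; have yb0 : 0 < y / b by rewrite divr_gt0.
have p0 := gamma_pdf_gt0 a_gt0 (@ltr01 R) yb0.
rewrite !C2E// !lower_itint_scale// !upper_itint_scale// gamma_pdf_scale//.
by field; rewrite !gt_eqF.
Qed.

End itint_scaling.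

Section constants.
Context {R : realType}.
Notation mu := (@lebesgue_measure R).
Variable a : R.
Hypothesis a_gt0 : 0 < a.
Local Notation p := (gamma_pdf a 1).
Local Notation A := (lower_itint a 1).
Local Notation B := (upper_itint a 1).
Implicit Types x y z : R.

Lemma le_Rintegral_itv0 (f : R -> R) x y : (forall z, 0 <= z -> 0 <= f z) ->
  mu.-integrable `[0, y] (EFin \o f) -> x <= y ->
  \int[mu]_(z in `[0, x]) f z <= \int[mu]_(z in `[0, y]) f z.
Proof.
move=> f0 fi xy.
have sub : `[0, x]%classic `<=` `[0, y]%classic by apply: subset_itvl; rewrite bnd_simp.
have fix_ : mu.-integrable `[0, x] (EFin \o f) by apply: integrableS fi.
apply: fine_le; [exact: integrable_fin_num|exact: integrable_fin_num|].
apply: ge0_subset_integral => //; first by case/integrableP: fi.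
by move=> z; rewrite /= in_itv/= => /andP[z0 _]; rewrite lee_fin f0.
Qed.

Lemma le_lower_itint k x y : 0 < y -> 0 <= x -> x <= y -> A k x <= A k y.
Proof.
move=> y0 x0 xy; case: k => [|k].
  apply: le_Rintegral_itv0 => //; first by move=> z _; exact: gamma_pdf_ge0.
  by apply: integrableS (integrable_gamma_pdf a_gt0 (@ltr01 R)).
rewrite -!lower_itintS ?(ltW y0)//.
apply: le_Rintegral_itv0 => //; first by move=> z; exact: lower_itint_ge0.
exact: integrable_lower_itint.
Qed.

(** [A k] is nondecreasing, so its integral over [[0, y]] is at most the length times the value at
    the right end. *)
Lemma lower_itintS_le k y : 0 < y -> A k.+1 y <= y * A k y.
Proof.
move=> y0; rewrite -lower_itintS ?(ltW y0)//.
have -> : y * A k y = \int[mu]_(_ in `[0, y]) A k y.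
  rewrite Rintegral_cst//= lebesgue_measure_itv/= lte_fin y0/=.
  by rewrite subr0 mulrC.
apply: le_Rintegral => //.
- exact: integrable_lower_itint.
- by apply: integrable_itv0 => // [x _|]; exact: cvg_cst.
- by move=> x; rewrite /= in_itv/= => /andP[x0 xy]; exact: le_lower_itint.
Qed.

Section bounds.
Variable y : R.
Hypothesis y0 : 0 < y.

Let s := y * p y.

Let s_gt0 : 0 < s.
Proof. by rewrite mulr_gt0 ?gamma_pdf_gt0. Qed.

Let Age0 k : 0 <= A k y.
Proof. by apply: lower_itint_ge0; rewrite ?ltW. Qed.

Let Bge0 k : 0 <= B k y.
Proof. exact: upper_itint_ge0. Qed.

Let cross : B 1 y * A 0 y + A 1 y * B 0 y = s.
Proof.
have := itint_cross a_gt0 (@ltr01 R) 0 y0.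
by rewrite !mul1r mulr1.
Qed.

(** The identity [cross] is a sum of two nonnegative terms, so each of them is at most [s]. *)
Let AB1 : A 0 y * B 1 y <= s.
Proof. by rewrite -cross mulrC lerDl mulr_ge0. Qed.

Let AB2 : A 1 y * B 0 y <= s.
Proof. by rewrite -cross lerDr mulr_ge0. Qed.

Let B2E : 2 * B 2 y = y * B 0 y - (y - a - 1) * B 1 y.
Proof.
by rewrite /upper_itint itintSS; field.
Qed.

(** [A_1 <= y A_0] reduces the numerator to [AB1]. *)
Lemma C1_le : C1 a 1 y <= 2.
Proof.
rewrite C1E// !mul1r -/s ler_pdivrMr ?(mulr_gt0 s_gt0 y0)// ler_pM2l//.
apply: (@le_trans _ _ (y * A 0 y * B 1 y)).
  by rewrite ler_wpM2r// lower_itintS_le.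
by rewrite -mulrA mulrC ler_pM2r.
Qed.

Lemma mulC1_le : y * C1 a 1 y <= 4 * (a + 1).
Proof.
have -> : y * C1 a 1 y = 2 * (A 1 y * B 1 y) / s.
  rewrite C1E// /s; field; rewrite !gt_eqF// gamma_pdf_gt0//.
rewrite ler_pdivrMr//.
(* Beyond this threshold [y - a - 1 >= y / 2]. There [B_2 >= 0], which reads
   [(y - a - 1) B_1 <= y B_0], yields [B_1 <= 2 B_0], and [AB2] applies. Below it,
   [A_1 B_1 <= y A_0 B_1 <= y s] is enough. *)
have [ya|ya] := leP y (2 * (a + 1)).
  have H1 : A 1 y * B 1 y <= y * A 0 y * B 1 y.
    by rewrite ler_wpM2r// lower_itintS_le.
  have H2 : y * (A 0 y * B 1 y) <= y * s by rewrite ler_pM2l.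
  have H3 : y * s <= 2 * (a + 1) * s by rewrite ler_pM2r.
  rewrite mulrA in H2; lra.
have H : B 1 y <= 2 * B 0 y.
  have := Bge0 2; rewrite -(pmulr_rge0 _ (ltr0n R 2)) B2E subr_ge0 => H.
  rewrite -(ler_pM2l y0); apply: (@le_trans _ _ (2 * ((y - a - 1) * B 1 y))); last first.
    by rewrite [leRHS]mulrCA ler_pM2l.
  by rewrite mulrA ler_wpM2r//; lra.
have H1 : A 1 y * B 1 y <= A 1 y * (2 * B 0 y) by rewrite ler_wpM2l.
have H2 : 2 * s <= (2 * a + 2) * s by rewrite ler_pM2r//; have := a_gt0; lra.
have H3 := AB2.
move: (A 1 y) (B 1 y) (B 0 y) s H1 H2 H3 => u v w t H1 H2 H3.
have : u * (2 * w) = 2 * (u * w) by ring.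
lra.
Qed.

(** Dropping [- y B_1] from the recurrence gives [2 B_2 <= y B_0 + (a + 1) B_1]. Against the first
    term [A_2 <= y A_1] is used, against the second [A_2 <= y^2 A_0]; both products are then at most
    [y^2 s], with total weight [a + 2]. *)
Lemma C2_le : C2 a 1 y <= 2 * (a + 2).
Proof.
have -> : C2 a 1 y = 2 * A 2 y * (2 * B 2 y) / (s * y ^+ 2).
  by rewrite C2E// /s !mul1r; field; rewrite !gt_eqF// gamma_pdf_gt0.
rewrite ler_pdivrMr ?(mulr_gt0 s_gt0 (exprn_gt0 _ y0))//.
have H0 : 2 * B 2 y <= y * B 0 y + (a + 1) * B 1 y.
  rewrite B2E; have := mulr_ge0 (ltW y0) (Bge0 1); lra.
apply: (@le_trans _ _ (2 * A 2 y * (y * B 0 y + (a + 1) * B 1 y))).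
  by rewrite ler_wpM2l// mulr_ge0.
have A2 : A 2 y <= y * A 1 y by exact: lower_itintS_le.
have A1 : A 1 y <= y * A 0 y by exact: lower_itintS_le.
have A2' : A 2 y <= y * (y * A 0 y) by rewrite (le_trans A2)// ler_pM2l.
have H1 : A 2 y * (y * B 0 y) <= y ^+ 2 * s.
  apply: (@le_trans _ _ (y * A 1 y * (y * B 0 y))).
    by rewrite ler_wpM2r// mulr_ge0// ltW.
  rewrite (_ : y * A 1 y * _ = y ^+ 2 * (A 1 y * B 0 y)); last by ring.
  by rewrite ler_pM2l ?exprn_gt0.
have H2 : A 2 y * B 1 y <= y ^+ 2 * s.
  apply: (@le_trans _ _ (y * (y * A 0 y) * B 1 y)).
    by rewrite ler_wpM2r.
  rewrite (_ : y * (y * A 0 y) * _ = y ^+ 2 * (A 0 y * B 1 y)); last by ring.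
  by rewrite ler_pM2l ?exprn_gt0.
have H3 : (a + 1) * (A 2 y * B 1 y) <= (a + 1) * (y ^+ 2 * s).
  by rewrite ler_wpM2l//; have := a_gt0; lra.
lra.
Qed.

End bounds.

Let sup_le (f : R -> R) (M z : R) : (forall y, 0 < y -> f y <= M) -> 0 < z ->
  f z <= sup [set f y | y in `]0, +oo[].
Proof.
move=> fM z0; apply: ub_le_sup; last by exists z => //; rewrite /= in_itv/= z0.
by exists M => _ [y /= + <-]; rewrite in_itv/= andbT; exact: fM.
Qed.

Lemma C1_le_c_const z : 0 < z -> C1 a 1 z <= c_const a.
Proof. by apply: sup_le => y y0; exact: C1_le. Qed.

Lemma mulC1_le_d_const z : 0 < z -> z * C1 a 1 z <= d_const a.
Proof. by apply: (@sup_le (fun z => z * C1 a 1 z)) => y y0; exact: mulC1_le. Qed.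

Lemma C2_le_e_const z : 0 < z -> C2 a 1 z <= e_const a.
Proof. by apply: sup_le => y y0; exact: C2_le. Qed.

End constants.

(** * Expectations against the kernels *)

Section density.
Context d (T : measurableType d) (R : realType).
Variables (mu nu : {measure set T -> \bar R}) (p : T -> R).
Hypothesis p_ge0 : forall x, 0 <= p x.
Hypothesis mp : measurable_fun setT p.
Hypothesis nuE : forall A, measurable A -> nu A = (\int[mu]_(x in A) (p x)%:E)%E.

Import HBNNSimple.

Let mpE : measurable_fun setT (EFin \o p).
Proof. exact/measurable_EFinP. Qed.

(** A simple function is a finite combination of indicators, and on indicators the claim is [nuE].
    Monotone approximation then extends it to nonnegative functions. *)
Lemma integral_density_nnsfun (h : {nnsfun T >-> R}) :
  (\int[nu]_x (h x)%:E = \int[mu]_x ((h x)%:E * (p x)%:E))%E.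
Proof.
have mi r : measurable_fun setT (fun x => (\1_(h @^-1` [set r]) x)%:E : \bar R).
  exact/measurable_EFinP/measurable_indic.
under eq_integral do rewrite fimfunE -fsumEFin//.
rewrite ge0_integral_fsum//; last 2 first.
  - by move=> r; exact/measurable_EFinP/measurable_funM.
  - by move=> r x _; exact: nnfun_muleindic_ge0.
under [RHS]eq_integral => x _.
  rewrite fimfunE -fsumEFin// ge0_mule_fsuml; last first.
    by move=> r; exact: nnfun_muleindic_ge0.
  over.
rewrite ge0_integral_fsum//; last 2 first.
  - move=> r; apply: emeasurable_funM => //.
    exact/measurable_EFinP/measurable_funM.
  - by move=> r x _; apply: mule_ge0; [exact: nnfun_muleindic_ge0|rewrite lee_fin].
apply: eq_fsbigr => r /[!inE] -[x _ <-].
under eq_integral do rewrite EFinM.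
under [RHS]eq_integral do rewrite EFinM -muleA.
rewrite !ge0_integralZl ?lee_fin//; last 2 first.
  - by apply: emeasurable_funM.
  - by move=> y _; rewrite mule_ge0 ?lee_fin ?p_ge0.
rewrite integral_indic// setIT nuE//; congr (_ * _)%E.
rewrite integral_mkcond; apply: eq_integral => y _.
by rewrite epatch_indic muleC.
Qed.

Lemma ge0_integral_density (f : T -> \bar R) :
  measurable_fun setT f -> (forall x, 0 <= f x)%E ->
  (\int[nu]_x f x = \int[mu]_x (f x * (p x)%:E))%E.
Proof.
move=> mf f0; pose h := nnsfun_approx measurableT mf.
have hf x : (h n x)%:E @[n --> \oo] --> f x by exact: cvg_nnsfun_approx.
transitivity (limn (fun n => \int[nu]_x (h n x)%:E)%E).
  rewrite -monotone_convergence//=.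
  - by apply: eq_integral => x _; apply/esym/cvg_lim.
  - by move=> n; exact/measurable_EFinP.
  - by move=> n x _; rewrite lee_fin.
  - by move=> x _ m n mn; rewrite lee_fin; exact/lefP/nd_nnsfun_approx.
under eq_fun do rewrite integral_density_nnsfun.
rewrite -monotone_convergence//=.
- apply: eq_integral => x _; apply/cvg_lim => //.
  by apply: cvgeZr => //; exact: hf.
- by move=> n; apply: emeasurable_funM => //; exact/measurable_EFinP.
- by move=> n x _; rewrite mule_ge0 ?lee_fin ?p_ge0.
- move=> x _ m n mn; rewrite lee_wpmul2r ?lee_fin ?p_ge0//.
  exact/lefP/nd_nnsfun_approx.
Qed.

End density.

Section gamma_dist_density.
Context {R : realType}.
Notation mu := (@lebesgue_measure R).
Variables a b : R.
Local Notation p := (gamma_pdf a b).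

(* The law lives on R with its default sigma-algebra while the Lebesgue measure
   lives on measurableTypeR R; the identity map transports one to the other. *)
Lemma ge0_integral_gamma_dist (f : R -> \bar R) :
  measurable_fun setT f -> (forall x, 0 <= f x)%E ->
  (\int[gamma_dist a b]_x f x = \int[mu]_x (f x * (p x)%:E))%E.
Proof.
move=> mf f0; pose phi : R -> measurableTypeR R := id.
have mphi : measurable_fun setT phi by move=> _ B mB; rewrite setTI.
pose nu : {measure set (measurableTypeR R) -> \bar R} :=
  measure_function_pushforward__canonical__measure_function_Measure (gamma_dist a b) mphi.
transitivity (\int[nu]_x f x)%E.
  by rewrite (ge0_integral_pushforward mphi).
rewrite (@ge0_integral_density _ _ _ mu nu p)//.
- exact: gamma_pdf_ge0.
- exact: measurable_gamma_pdf.
Qed.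

(** Positive and negative parts are treated separately; the nonnegative density moves inside the
    maximum defining each part. *)
Lemma Rintegral_gamma_dist (f : R -> R) : measurable_fun setT f ->
  \int[gamma_dist a b]_x f x = \int[mu]_x (f x * p x).
Proof.
move=> mf; have mfE : measurable_fun setT (EFin \o f) by exact/measurable_EFinP.
have p0 : forall x, 0 <= p x by exact: gamma_pdf_ge0.
rewrite /Rintegral integralE [in RHS]integralE; congr (fine (_ - _)).
- rewrite ge0_integral_gamma_dist//; last exact: measurable_funepos.
  apply: eq_integral => x _; rewrite !funeposE/= EFinM.
  by rewrite maxe_pMl ?lee_fin// mul0e.
- rewrite ge0_integral_gamma_dist//; last exact: measurable_funeneg.
  apply: eq_integral => x _; rewrite !funenegE/= -mulNr EFinM.
  by rewrite maxe_pMl ?lee_fin// mul0e.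
Qed.

End gamma_dist_density.

Section kernel_expectation.
Context {R : realType}.
Notation mu := (@lebesgue_measure R).
Variables (a b : R).
Hypothesis a_gt0 : 0 < a.
Hypothesis b_gt0 : 0 < b.
Local Notation p := (gamma_pdf a b).
Local Notation A := (lower_itint a b).
Local Notation B := (upper_itint a b).
Implicit Types (x y u c : R) (w : R -> R) (k : nat).

(** The density of the law cancels the division by [p] in the kernel, leaving one integral on each
    side of [x]. [F] and [G] are generic so that [K1] and [K32] are both covered. *)
Lemma gamma_expectation_kernel w (F G : R -> R) (al be x : R) : 0 < x ->
  (forall u, 0 < u -> {for u, continuous w}) ->
  (forall u, 0 < u -> {for u, continuous F}) ->
  (forall u, 0 < u -> {for u, continuous G}) ->
  mu.-integrable `[0, x] (EFin \o (fun u => w u * F u)) ->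
  mu.-integrable `[x, +oo[ (EFin \o (fun u => w u * G u)) ->
  gamma_expectation a b (fun u => w u * (al * (F u / p u) * (u <= x)%R%:R
     + be * (G u / p u) * (u > x)%R%:R)) =
  al * \int[mu]_(u in `[0, x]) (w u * F u)
  + be * \int[mu]_(u in `[x, +oo[) (w u * G u).
Proof.
move=> x0 cw cF cG iF iG.
have mE (H : R -> R) (c : R) : (forall u, 0 < u -> {for u, continuous H}) ->
    measurable_fun (`]0, +oo[ : set R) (fun u => c * (w u * (H u / p u))).
  move=> cH; apply: open_continuous_measurable_fun => // u.
  rewrite inE/= in_itv/= andbT => u0.
  apply: cvgM; first exact: cvg_cst.
  apply: cvgM; first exact: cw.
  apply: cvgM; first exact: cH.
  apply: cvgV; first by rewrite gt_eqF// gamma_pdf_gt0.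
  exact: continuous_gamma_pdf.
pose g1 := (fun u => al * (w u * (F u / p u))) \_ `]0, x].
pose g2 := (fun u => be * (w u * (G u / p u))) \_ `]x, +oo[.
have mg1 : measurable_fun setT g1.
  apply/(measurable_restrictT _ _).1 => //; apply: measurable_funS (mE F al cF) => //.
  exact: subset_itvl.
have mg2 : measurable_fun setT g2.
  apply/(measurable_restrictT _ _).1 => //; apply: measurable_funS (mE G be cG) => //.
  by apply: subset_itvr; rewrite bnd_simp ltW.
rewrite /gamma_expectation.
rewrite (_ : (fun u => _) = g1 \+ g2); last first.
  apply/funext => u; rewrite /g1 /g2 /= !patchE.
  (* For [u <= 0] the density is 0 and so is its inverse, hence the kernel vanishes there like the
     two restrictions. *)
  have [u0|u0] := leP u 0.
    rewrite gamma_pdf_npos// invr0 !mulr0 !mul0r addr0 mulr0.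
    rewrite !memNset ?addr0//= in_itv/= ?ltNge ?u0//.
    by rewrite andbT (le_trans u0)// ltW.
  have [ux|ux] := leP u x.
    rewrite mem_set/= ?in_itv/= ?u0// memNset/= ?in_itv/= ?ltNge ?ux//.
    by rewrite !mulr1 mulr0 !addr0 mulrCA.
  rewrite memNset/= ?in_itv/= ?(leNgt u) ?ux ?andbF// mem_set/= ?in_itv/= ?ux//.
  by rewrite !mulr1 mulr0 !add0r mulrCA.
rewrite Rintegral_gamma_dist; last exact: measurable_funD.
have iF' : mu.-integrable `]0, x] (EFin \o (fun u => w u * F u)).
  by apply: integrableS iF => //; apply: subset_itvr; rewrite bnd_simp.
have iG' : mu.-integrable `]x, +oo[ (EFin \o (fun u => w u * G u)).
  by apply: integrableS iG => //; apply: subset_itvr; rewrite bnd_simp.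
transitivity (\int[mu]_u
    (((fun u => al * (w u * F u)) \_ `]0, x]) u +
    ((fun u => be * (w u * G u)) \_ `]x, +oo[) u)).
  apply: eq_Rintegral => u _; rewrite /g1 /g2 /= mulrDl !patchE.
  congr (_ + _); case: ifPn; rewrite ?mul0r// inE/= in_itv/= => ux.
    have u0 : 0 < u by case/andP: ux.
    by field; rewrite gt_eqF// gamma_pdf_gt0.
  have u0 : 0 < u by rewrite (lt_trans x0)//; case/andP: ux.
  by field; rewrite gt_eqF// gamma_pdf_gt0.
have iZ (D : set R) (H : R -> R) (c : R) : @measurable _ (measurableTypeR R) D ->
    mu.-integrable D (EFin \o H) ->
    mu.-integrable setT (EFin \o ((fun u => c * H u) \_ D)).
  move=> mD iH; rewrite -restrict_EFin; apply/integrable_restrict => //=.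
  by rewrite setTI; exact: (integrableZl mD c iH).
rewrite RintegralD//; last 2 first.
- exact: iZ.
- exact: iZ.
rewrite -!Rintegral_mkcond !RintegralZl//.
by rewrite !Rintegral_itv_obnd_cbnd.
Qed.

(** A growth class that contains [h'] in both cases: bounded by 1 for [Z1], Lipschitz for [Z2]. *)
Definition affinely_bounded w := exists c, forall u, 0 < u -> `|w u| <= c + u.

Lemma affinely_bounded_le1 w : (forall u, 0 < u -> `|w u| <= 1) -> affinely_bounded w.
Proof. by move=> w1; exists 1 => u u0; rewrite (le_trans (w1 _ u0))// lerDl ltW. Qed.

Section affine_weight.
Variable w : R -> R.
Hypothesis cw : forall u, 0 < u -> {for u, continuous w}.
Hypothesis wb : affinely_bounded w.

Lemma weighted_lower_cvg0 k : w u * A k u @[u --> 0^'+] --> (0 : R).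
Proof.
have [c wc] := wb.
have H : (c + u) * A k u @[u --> 0^'+] --> (0 : R).
  rewrite -[X in _ --> X](mulr0 (c + 0)); apply: cvgM; last exact: lower_itint_cvg0.
  by apply: cvgD; [exact: cvg_cst|apply: cvg_at_right_filter; exact: cvg_id].
apply: (@squeeze_cvgr _ _ _ _ (fun u => - ((c + u) * A k u)) (fun u => (c + u) * A k u)) => //.
  near=> u; have u0 : 0 < u by near: u; exact: nbhs_right_gt.
  have A0 : 0 <= A k u by apply: lower_itint_ge0 => //; exact: ltW.
  by rewrite -ler_norml normrM (ger0_norm A0) ler_wpM2r// wc.
by rewrite -[X in _ --> X]oppr0; apply: cvgN.
Unshelve. all: by end_near. Qed.

Lemma integrable_weighted_lower k x : 0 < x ->
  mu.-integrable `[0, x] (EFin \o (fun u => w u * A k u)).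
Proof.
move=> x0; apply: integrable_itv0 => //.
  by move=> u u0; apply: cvgM; [exact: cw|exact: continuous_lower_itint].
by rewrite lower_itint0// mulr0; exact: weighted_lower_cvg0.
Qed.

Lemma affine_upper_decay c k : (c + u) * B k u @[u --> +oo%R] --> (0 : R).
Proof.
have D0 := upper_itint_decay a_gt0 b_gt0 k 0.
have D1 := upper_itint_decay a_gt0 b_gt0 k 1.
have : c * (u ^+ 0 * B k u) + u ^+ 1 * B k u @[u --> +oo%R] --> c * 0 + (0 : R).
  by apply: cvgD => //; apply: cvgM => //; exact: cvg_cst.
rewrite mulr0 addr0; apply: cvg_trans; apply: near_eq_cvg; near=> u.
by rewrite expr0 expr1 mul1r mulrDl.
Unshelve. all: by end_near. Qed.

(** Integration by parts gives an explicit primitive of the dominating function [(c + u) B_k]. *)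
Lemma is_derive_affine_upper c k u : 0 < u ->
  is_derive u 1 (fun u => - ((c + u) * B k.+1 u) - B k.+2 u) ((c + u) * B k u).
Proof.
move=> u0.
have d1 := is_derive_upper_itint a_gt0 b_gt0 k u0.
have d2 := is_derive_upper_itint a_gt0 b_gt0 k.+1 u0.
move: d1 d2; move: (B k) (B k.+1) (B k.+2) => B0 B1 B2 d1 d2.
apply: is_derive_eq; rewrite /GRing.scale/=.
by ring.
Qed.

Lemma affine_upper_primitive_cvg c k :
  - ((c + u) * B k.+1 u) - B k.+2 u @[u --> +oo%R] --> (0 : R).
Proof.
rewrite -[X in _ --> X]subr0 -[X in _ --> X - _]oppr0; apply: cvgB.
  by apply: cvgN; exact: affine_upper_decay.
have := upper_itint_decay a_gt0 b_gt0 k.+2 0; apply: cvg_trans.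
by apply: near_eq_cvg; near=> u; rewrite expr0 mul1r.
Unshelve. all: by end_near. Qed.

Lemma continuous_affine_upper c k u : 0 < u ->
  {for u, continuous (fun u => (c + u) * B k u)}.
Proof.
move=> u0; apply: cvgM; last exact: continuous_upper_itint.
by apply: cvgD; [exact: cvg_cst|exact: cvg_id].
Qed.

Lemma integrable_weighted_upper k x : 0 < x ->
  mu.-integrable `[x, +oo[ (EFin \o (fun u => w u * B k u)).
Proof.
move=> x0; have [c wc] := wb.
have d0 u : 0 < u -> 0 <= (c + u) * B k u.
  by move=> u0; rewrite mulr_ge0 ?upper_itint_ge0// (le_trans _ (wc _ u0)).
have := ge0_integrable_itvcy x0 d0 (@continuous_affine_upper c k)
  (@is_derive_affine_upper c k) (affine_upper_primitive_cvg c k).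
apply: le_integrable => //.
  apply/measurable_EFinP; apply: measurable_itvcy => // u u0.
  by apply: cvgM; [exact: cw|exact: continuous_upper_itint].
move=> u; rewrite /= in_itv/= andbT => xu; have u0 := lt_le_trans x0 xu.
have B0 : 0 <= B k u by exact: upper_itint_ge0.
by rewrite lee_fin normrM [leRHS]ger0_norm ?d0// (ger0_norm B0) ler_wpM2r// wc.
Qed.

End affine_weight.

End kernel_expectation.

(** * Bounds for expectations against weights of modulus at most one *)

Section kernel_bounds.
Context {R : realType}.
Notation mu := (@lebesgue_measure R).
Variables (a b : R).
Hypothesis a_gt0 : 0 < a.
Hypothesis b_gt0 : 0 < b.
Local Notation p := (gamma_pdf a b).
Local Notation A := (lower_itint a b).
Local Notation B := (upper_itint a b).
Implicit Types (x y u c : R) (w : R -> R) (k : nat).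

Section unit_weight.
Variable w : R -> R.
Hypothesis cw : forall u, 0 < u -> {for u, continuous w}.
Hypothesis w1 : forall u, 0 < u -> `|w u| <= 1.

Let wb := affinely_bounded_le1 w1.

Lemma normr_weighted_lower k x : 0 < x ->
  `|\int[mu]_(u in `[0, x]) (w u * A k u)| <= A k.+1 x.
Proof.
move=> x0; have iw := integrable_weighted_lower a_gt0 b_gt0 cw wb k x0.
apply: (le_trans (le_normr_Rintegral _ iw)) => //.
rewrite -lower_itintS ?(ltW x0)//; apply: le_Rintegral => //.
- exact: (integrable_norm iw).
- exact: integrable_lower_itint.
- move=> u; rewrite /= in_itv/= => /andP[u0 ux].
  have A0 : 0 <= A k u by exact: lower_itint_ge0.
  (* Nothing bounds [w] at 0 itself, but [A k] vanishes there. *)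
  move: u0; rewrite le_eqVlt => /predU1P[<-|u0].
    by rewrite lower_itint0// mulr0 normr0.
  by rewrite normrM (ger0_norm A0) ler_piMl// w1.
Qed.

Lemma normr_weighted_upper k x : 0 < x ->
  `|\int[mu]_(u in `[x, +oo[) (w u * B k u)| <= B k.+1 x.
Proof.
move=> x0; have iw := integrable_weighted_upper a_gt0 b_gt0 cw wb k x0.
apply: (le_trans (le_normr_Rintegral _ iw)) => //.
rewrite -upper_itintS//; apply: le_Rintegral => //.
- exact: (integrable_norm iw).
- exact: integrable_upper_itint.
- move=> u; rewrite /= in_itv/= andbT => xu; have u0 := lt_le_trans x0 xu.
  have B0 : 0 <= B k u by exact: upper_itint_ge0.
  by rewrite normrM (ger0_norm B0) ler_piMl// w1.
Qed.

Lemma normr_weighted_sum (al be : R) k x : 0 < x ->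
  `|al * \int[mu]_(u in `[0, x]) (w u * A k u)
    + be * \int[mu]_(u in `[x, +oo[) (w u * B k u)| <=
  `|al| * A k.+1 x + `|be| * B k.+1 x.
Proof.
move=> x0.
have := normr_weighted_lower k x0; have := normr_weighted_upper k x0.
move: (\int[mu]_(u in `[0, x]) _) (\int[mu]_(u in _) _) => I J HJ HI.
apply: (le_trans (ler_normD _ _)); rewrite !normrM.
by apply: lerD; apply: ler_wpM2l.
Qed.

End unit_weight.

Lemma normr_derive1n_M_lower k x : 0 < x -> `|derive1n k (M_lower a b) x| =
  k`!%:R * A k x / (b * x * p x * (b * x) ^+ k).
Proof.
move=> x0; rewrite derive1n_M_lower// ger0_norm// divr_ge0//.
  by rewrite mulr_ge0// lower_itint_ge0// ltW.
by rewrite !mulr_ge0 ?exprn_ge0 ?mulr_ge0 ?gamma_pdf_ge0 ?ltW.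
Qed.

Lemma normr_derive1n_M_upper k x : 0 < x -> `|derive1n k (M_upper a b) x| =
  k`!%:R * B k x / (b * x * p x * (b * x) ^+ k).
Proof.
move=> x0; rewrite derive1n_M_upper// normrM normrX normrN1 expr1n mul1r.
rewrite ger0_norm// divr_ge0//.
  by rewrite mulr_ge0// upper_itint_ge0.
by rewrite !mulr_ge0 ?exprn_ge0 ?mulr_ge0 ?gamma_pdf_ge0 ?ltW.
Qed.

Lemma gamma_expectation_K1 w k x : 0 < x ->
  (forall u, 0 < u -> {for u, continuous w}) -> affinely_bounded w ->
  gamma_expectation a b (fun u => w u * K1 a b k u x) =
  - derive1n k (M_upper a b) x * \int[mu]_(u in `[0, x]) (w u * A 0 u)
  + - derive1n k (M_lower a b) x * \int[mu]_(u in `[x, +oo[) (w u * B 0 u).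
Proof.
move=> x0 cw wb.
rewrite -(gamma_expectation_kernel a_gt0 b_gt0 (F := A 0) (G := B 0) _ _ x0 cw).
- by congr gamma_expectation; apply/funext => u; rewrite /K1 !mulNr.
- exact: continuous_lower_itint.
- exact: continuous_upper_itint.
- exact: integrable_weighted_lower.
- exact: integrable_weighted_upper.
Qed.

Lemma gamma_expectation_K32 w x : 0 < x ->
  (forall u, 0 < u -> {for u, continuous w}) -> affinely_bounded w ->
  gamma_expectation a b (fun u => w u * K32 a b u x) =
  derive1n 3 (M_upper a b) x * \int[mu]_(u in `[0, x]) (w u * A 1 u)
  + - derive1n 3 (M_lower a b) x * \int[mu]_(u in `[x, +oo[) (w u * B 1 u).
Proof.
move=> x0 cw wb.
rewrite -(gamma_expectation_kernel a_gt0 b_gt0 (F := A 1) (G := B 1) _ _ x0 cw).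
- have alg (v D E F G F' G' i j : R) :
      v * (D * (F * 0) * i - E * (G * 0) * j) =
      v * (D * (F' * 0) * i + - E * (G' * 0) * j) by ring.
  congr gamma_expectation; apply/funext => u; rewrite /K32.
  have [u0|u0] := leP u 0.
    by rewrite (gamma_pdf_npos a b u0) invr0; exact: alg.
  by rewrite (P1_lowerE a_gt0 b_gt0 (ltW u0)) (P1_upperE a_gt0 b_gt0 u0) !mulNr.
- exact: continuous_lower_itint.
- exact: continuous_upper_itint.
- exact: integrable_weighted_lower.
- exact: integrable_weighted_upper.
Qed.

Section bounds.
Variable w : R -> R.
Hypothesis cw : forall u, 0 < u -> {for u, continuous w}.
Hypothesis w1 : forall u, 0 < u -> `|w u| <= 1.

Lemma normr_expectation_K1 k x : 0 < x ->
  `|gamma_expectation a b (fun u => w u * K1 a b k u x)| <=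
  k`!%:R * (B k x * A 1 x + A k x * B 1 x) / (b * x * p x * (b * x) ^+ k).
Proof.
move=> x0; rewrite gamma_expectation_K1//; last exact: affinely_bounded_le1.
have := normr_derive1n_M_upper k x0; have := normr_derive1n_M_lower k x0.
generalize (derive1n k (M_lower a b) x) (derive1n k (M_upper a b) x) => dM dN HM HN.
apply: (le_trans (normr_weighted_sum cw w1 _ _ _ x0)); rewrite !normrN HM HN.
by rewrite le_eqVlt; apply/predU1P; left; ring.
Qed.

(** Integrating [A_1] and [B_1] raises the index to 2, so [itint_cross] at [k = 2] evaluates the
    bound exactly. *)
Lemma normr_expectation_K32 x : 0 < x ->
  `|gamma_expectation a b (fun u => w u * K32 a b u x)| <= (b * x)^-1.
Proof.
move=> x0; rewrite gamma_expectation_K32//; last exact: affinely_bounded_le1.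
have := normr_derive1n_M_upper 3 x0; have := normr_derive1n_M_lower 3 x0.
generalize (derive1n 3 (M_lower a b) x) (derive1n 3 (M_upper a b) x) => dM dN HM HN.
apply: (le_trans (normr_weighted_sum cw w1 _ _ _ x0)); rewrite normrN HM HN.
have p0 := gamma_pdf_gt0 a_gt0 b_gt0 x0.
have -> : 3`!%:R * B 3 x / (b * x * p x * (b * x) ^+ 3) * A 2 x +
    3`!%:R * A 3 x / (b * x * p x * (b * x) ^+ 3) * B 2 x =
    3`!%:R * (B 3 x * A 2 x + A 3 x * B 2 x) / (b * x * p x * (b * x) ^+ 3) by ring.
by rewrite itint_cross// le_eqVlt; apply/predU1P; left; field; rewrite !gt_eqF.
Qed.

Lemma normr_expectation_K10 x : 0 < x ->
  `|gamma_expectation a b (fun u => w u * K1 a b 0 u x)| <= 1.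
Proof.
move=> x0; apply: (le_trans (normr_expectation_K1 0 x0)).
have := itint_cross a_gt0 b_gt0 0 x0; rewrite expr0 mulr1 mul1r => E.
rewrite mul1r addrC.
have -> : A 0 x * B 1 x + B 0 x * A 1 x = b * x * p x by rewrite -E; ring.
by rewrite divff// gt_eqF// !mulr_gt0// gamma_pdf_gt0.
Qed.

Lemma normr_expectation_K11 x : 0 < x ->
  `|gamma_expectation a b (fun u => w u * K1 a b 1 u x)| <= C1 a b x.
Proof.
move=> x0; apply: (le_trans (normr_expectation_K1 1 x0)).
by rewrite C1E// le_eqVlt; apply/predU1P; left; rewrite expr1 mul1r; ring.
Qed.

(** This exact value serves twice: it bounds the expectation against [K1] of order 2, and it cancels
    the boundary terms in [normr_expectation_C2]. *)
Lemma itint_cross2 x : 0 < x ->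
  2 * (B 2 x * A 1 x + A 2 x * B 1 x) / (b * x * p x * (b * x) ^+ 2) = (b * x)^-1.
Proof.
move=> x0; have p0 := gamma_pdf_gt0 a_gt0 b_gt0 x0.
have -> : 2 = 2`!%:R :> R by [].
by rewrite itint_cross//; field; rewrite !gt_eqF.
Qed.

Lemma normr_expectation_K12 x : 0 < x ->
  `|gamma_expectation a b (fun u => w u * K1 a b 2 u x)| <= (b * x)^-1.
Proof. by move=> x0; rewrite -itint_cross2//; exact: normr_expectation_K1. Qed.

End bounds.

End kernel_bounds.

(** * Integration by parts for weights with bounded derivative *)

Section integration_by_parts.
Context {R : realType}.
Notation mu := (@lebesgue_measure R).
Variables (a b : R).
Hypothesis a_gt0 : 0 < a.
Hypothesis b_gt0 : 0 < b.
Local Notation p := (gamma_pdf a b).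
Local Notation A := (lower_itint a b).
Local Notation B := (upper_itint a b).
Implicit Types (x y u c : R) (k : nat).

Variables w dw : R -> R.
Hypothesis dwP : forall u, 0 < u -> is_derive u 1 w (dw u).
Hypothesis cdw : forall u, 0 < u -> {for u, continuous dw}.
Hypothesis dw1 : forall u, 0 < u -> `|dw u| <= 1.

Let cw u : 0 < u -> {for u, continuous w}.
Proof. by move=> u0; exact: is_derive_continuous (dwP u0). Qed.

Let dwb := affinely_bounded_le1 dw1.

Lemma affinely_bounded_primitive : affinely_bounded w.
Proof.
have lip u v : 0 < u -> u < v -> `|w v - w u| <= v - u.
  move=> u0 uv; have [| |c] := @MVT _ w dw u v uv.
  - by move=> z; rewrite in_itv/= => /andP[uz _]; apply: dwP; exact: lt_trans uz.
  - apply: continuous_in_subspaceT => z; rewrite inE/= in_itv/= => /andP[uz _].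
    by apply: cw; exact: lt_le_trans uz.
  - rewrite in_itv/= => /andP[uc _] ->.
    rewrite normrM [X in _ * X]ger0_norm; last by rewrite subr_ge0 ltW.
    by rewrite ler_piMl ?subr_ge0 ?(ltW uv)// dw1// (lt_trans u0 uc).
(* The mean value theorem is applied from the base point 1, with [|u - 1| <= 1 + u] for positive
   [u]. *)
exists (`|w 1| + 1) => u u0.
have H : `|w u - w 1| <= 1 + u.
  have [u1|u1|->] := ltgtP u 1.
  - by rewrite distrC (le_trans (lip _ _ u0 u1))//; lra.
  - by rewrite (le_trans (lip _ _ ltr01 u1))//; lra.
  - by rewrite subrr normr0 addr_ge0.
rewrite -(subrK (w 1) (w u)) (le_trans (ler_normD _ _))//.
by rewrite addrC -addrA lerD2l.
Qed.

Let wb := affinely_bounded_primitive.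

(** The boundary term at 0 disappears because [w] is bounded near 0 while [A_1] tends to 0. *)
Lemma weighted_lower_by_parts x : 0 < x ->
  \int[mu]_(u in `[0, x]) (w u * A 0 u) =
  w x * A 1 x - \int[mu]_(u in `[0, x]) (dw u * A 1 u).
Proof.
move=> x0.
have iw := integrable_weighted_lower a_gt0 b_gt0 cw wb 0 x0.
have idw := integrable_weighted_lower a_gt0 b_gt0 cdw dwb 1 x0.
have A00 k : A k 0 = 0 by exact: lower_itint0.
have c1 u : 0 < u -> {for u, continuous (fun u => dw u * A 1 u + w u * A 0 u)}.
  move=> u0; apply: cvgD; apply: cvgM.
  - exact: cdw.
  - exact: continuous_lower_itint.
  - exact: cw.
  - exact: continuous_lower_itint.
have c0 : dw u * A 1 u + w u * A 0 u @[u --> 0^'+] --> dw 0 * A 1 0 + w 0 * A 0 0.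
  rewrite !A00 !mulr0; apply: cvgD; exact: weighted_lower_cvg0.
have dF u : 0 < u -> is_derive u 1 (fun u => w u * A 1 u) (dw u * A 1 u + w u * A 0 u).
  move=> u0; have d1 := dwP u0; have d2 := is_derive_lower_itint a_gt0 b_gt0 0 u0.
  move: (A 1) (A 0) d2 => A1 A0 d2.
  by apply: is_derive_eq; rewrite /GRing.scale/=; ring.
have F0 : w u * A 1 u @[u --> 0^'+] --> w 0 * A 1 0.
  by rewrite A00 mulr0; exact: weighted_lower_cvg0.
have := FTC2_itv0 x0 c1 c0 dF F0.
rewrite A00 mulr0 subr0 => E.
have H := RintegralD _ idw iw; have {H} := H (measurable_itv _).
rewrite /Rintegral E/= => ->.
by rewrite addrC addKr.
Qed.

Lemma weighted_upper_by_parts x : 0 < x ->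
  \int[mu]_(u in `[x, +oo[) (w u * B 0 u) =
  w x * B 1 x + \int[mu]_(u in `[x, +oo[) (dw u * B 1 u).
Proof.
move=> x0; have [c wc] := wb.
have iw := integrable_weighted_upper a_gt0 b_gt0 cw wb 0 x0.
have idw := integrable_weighted_upper a_gt0 b_gt0 cdw dwb 1 x0.
have B0 k u : 0 < u -> 0 <= B k u by exact: upper_itint_ge0.
pose f u := dw u * B 1 u - w u * B 0 u.
(* The integrand [f] may change sign. It is dominated by [B_1 + (c + u) B_0], of which [D] is a
   primitive with limit 0 at infinity. *)
pose D u := - B 2 u + (- ((c + u) * B 1 u) - B 2 u).
have cf u : 0 < u -> {for u, continuous f}.
  move=> u0; apply: cvgB; apply: cvgM.
  - exact: cdw.
  - exact: continuous_upper_itint.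
  - exact: cw.
  - exact: continuous_upper_itint.
have dF u : 0 < u -> is_derive u 1 (fun u => w u * B 1 u) (f u).
  move=> u0; have d1 := dwP u0; have d2 := is_derive_upper_itint a_gt0 b_gt0 0 u0.
  rewrite /f; move: (B 1) (B 0) d2 => B1 B0' d2.
  by apply: is_derive_eq; rewrite /GRing.scale/=; ring.
have Fl : w u * B 1 u @[u --> +oo%R] --> (0 : R).
  have H := affine_upper_decay a_gt0 b_gt0 c 1.
  apply: (@squeeze_cvgr _ _ _ _ (fun u => - ((c + u) * B 1 u)) (fun u => (c + u) * B 1 u)) => //.
    near=> u; have u0 : 0 < u by near: u; apply: nbhs_pinfty_gt; exact: num_real.
    by rewrite -ler_norml normrM (ger0_norm (B0 1 _ u0)) ler_wpM2r ?B0// wc.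
  by rewrite -[X in _ --> X]oppr0; apply: cvgN.
have fd u : 0 < u -> `|f u| <= B 1 u + (c + u) * B 0 u.
  move=> u0; apply: (le_trans (ler_normB _ _)); rewrite (normrM (dw u)) (normrM (w u)).
  rewrite (ger0_norm (B0 1 _ u0)) (ger0_norm (B0 0 _ u0)); apply: lerD.
    by apply: ler_piMl; [exact: B0|exact: dw1].
  by apply: ler_wpM2r; [exact: B0|exact: wc].
have cd u : 0 < u -> {for u, continuous (fun u => B 1 u + (c + u) * B 0 u)}.
  move=> u0; apply: cvgD; first exact: continuous_upper_itint.
  exact: continuous_affine_upper.
have dD u : 0 < u -> is_derive u 1 D (B 1 u + (c + u) * B 0 u).
  move=> u0; apply: is_deriveD; last exact: is_derive_affine_upper.
  rewrite -[X in is_derive _ _ _ X]opprK; apply: is_deriveN.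
  exact: is_derive_upper_itint.
have Dm : D u @[u --> +oo%R] --> (0 : R).
  rewrite -[X in _ --> X]addr0; apply: cvgD; last exact: affine_upper_primitive_cvg.
  rewrite -[X in _ --> X]oppr0; apply: cvgN.
  have := upper_itint_decay a_gt0 b_gt0 2 0; apply: cvg_trans.
  by apply: near_eq_cvg; near=> u; rewrite expr0 mul1r.
have [_ E] := dominated_FTC2_itvcy x0 cf dF Fl fd cd dD Dm.
have H := RintegralB _ idw iw; have {H} := H (measurable_itv _).
rewrite -/(f _) E sub0r => H.
lra.
Unshelve. all: by end_near. Qed.

Lemma normr_expectation_C2 x : 0 < x ->
  `|gamma_expectation a b (fun u => w u * K1 a b 2 u x) + w x / (b * x)| <= C2 a b x.
Proof.
move=> x0; rewrite gamma_expectation_K1//.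
rewrite weighted_lower_by_parts// weighted_upper_by_parts//.
have := normr_derive1n_M_upper a_gt0 b_gt0 2 x0.
have := normr_derive1n_M_lower a_gt0 b_gt0 2 x0.
have := derive1n_M_upper a_gt0 b_gt0 2 x0.
have := derive1n_M_lower a_gt0 b_gt0 2 x0.
generalize (derive1n 2 (M_lower a b) x) (derive1n 2 (M_upper a b) x).
move=> dM dN EM EN nM nN.
have H := normr_weighted_sum a_gt0 b_gt0 cdw dw1 dN (- dM) 1 x0.
move: H; set I := \int[mu]_(u in `[0, x]) _; set J := \int[mu]_(u in _) _.
rewrite normrN nM nN => H.
have -> : - dN * (w x * A 1 x - I) + - dM * (w x * B 1 x + J) + w x / (b * x)
   = dN * I + - dM * J.
  (* The boundary terms of the two integrations by parts add up to [- w x (dN A_1 + dM B_1)]; by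
     [itint_cross2] the added term is their opposite, and only integrals of [dw] remain. *)
  have -> : w x / (b * x) = w x * (dN * A 1 x + dM * B 1 x).
    rewrite EM EN -(itint_cross2 a_gt0 b_gt0 x0) sqrrN expr1n.
    rewrite (_ : 2`! = 2%N :> nat)//; ring.
  by ring.
apply: (le_trans H); rewrite C2E//.
rewrite le_eqVlt; apply/predU1P; left.
by rewrite (_ : 2`! = 2%N :> nat)//; ring.
Qed.

End integration_by_parts.

(** * From pointwise bounds to the norms *)

Lemma supnorm_le {R : realType} (f : R -> R) (c : R) :
  (supnorm f <= c%:E)%E <-> forall x, 0 < x -> `|f x| <= c.
Proof.
split=> [H x x0|H].
  rewrite -lee_fin; apply: le_trans H; apply: ereal_sup_ubound.
  by exists x => //; rewrite /= in_itv/= x0.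
apply: ge_ereal_sup => _ [x /= + <-]; rewrite in_itv/= andbT lee_fin.
exact: H.
Qed.

Local Open Scope ereal_scope.

Theorem lemma1p8 (R : realType) (a b : R) (a_gt0 : (0 < a)%R) (b_gt0 : (0 < b)%R)
    (h : R -> R) :
  (Z1 h ->
    [/\ supnorm (stein_sol a b h) <= 1,
        supnorm (stein_sol' a b h) <= (c_const a / b)%:E,
        supnorm (fun x => x * stein_sol' a b h x)%R <= (d_const a)%:E &
        supnorm (fun x => x * stein_sol'' a b h x)%R <= (2 / b)%:E]) /\
  (Z2 h ->
    supnorm (stein_sol'' a b h) <= (e_const a / b)%:E /\
    supnorm (fun x => x * stein_sol''' a b h x)%R <= (2 / b)%:E).
Proof.
(* Both bounds [2 / b] arise in the same way: the kernel expectation and the local term each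
   contribute at most [1 / (b x)]. *)
have two x : (0 < x)%R -> forall e t : R, (`|e| <= (b * x)^-1)%R -> (`|t| <= 1)%R ->
    (`|x * (e + t / (b * x))| <= 2 / b)%R.
  move=> x0 e t e1 t1; rewrite normrM (gtr0_norm x0).
  have bx0 : (0 < (b * x)^-1)%R by rewrite invr_gt0 mulr_gt0.
  have -> : (2 / b = x * ((b * x)^-1 + (b * x)^-1))%R.
    by field; rewrite !gt_eqF.
  rewrite ler_pM2l//; apply: (le_trans (ler_normD _ _)); apply: lerD => //.
  by rewrite normrM (gtr0_norm bx0) ler_piMl// ltW.
have yb0 x : (0 < x)%R -> (0 < x / b)%R by move=> x0; rewrite divr_gt0.
split.
- move=> [_ ch /supnorm_le h1]; split; apply/supnorm_le => x x0.
  + exact: normr_expectation_K10.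
  + apply: (le_trans (normr_expectation_K11 a_gt0 b_gt0 ch h1 x0)).
    by rewrite C1_scale// ler_pM2r ?invr_gt0// C1_le_c_const// yb0.
  + rewrite normrM (gtr0_norm x0).
    apply: (@le_trans _ _ (x * C1 a b x)%R).
      by rewrite ler_pM2l//; exact: normr_expectation_K11.
    (* After rescaling, the factors combine to [(x / b) C1 a 1 (x / b)], so no power of [b] is left
       in the bound. *)
    rewrite C1_scale// mulrCA mulrC -mulrA.
    have := mulC1_le_d_const a_gt0 (yb0 _ x0); apply: le_trans.
    by rewrite le_eqVlt; apply/predU1P; left; field; rewrite gt_eqF.
  + apply: two => //; last exact: h1.
    exact: normr_expectation_K12.
- move=> [_ dh ch /supnorm_le h1].
  (* The integration by parts is used with [w = h'] and [dw = h'']. *)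
  have dhP (u : R) : (0 < u)%R -> is_derive u 1%R (derive1n 1 h) (derive1n 2 h u).
    move=> u0; apply: DeriveDef; first exact: dh.
    by rewrite [derive1n 2 h]derive1nS derive1E.
  split; apply/supnorm_le => x x0.
  + apply: (le_trans (normr_expectation_C2 a_gt0 b_gt0 dhP ch h1 x0)).
    by rewrite C2_scale// ler_pM2r ?invr_gt0// C2_le_e_const// yb0.
  + apply: two => //; last exact: h1.
    exact: normr_expectation_K32.
Qed.
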